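(* Let $\{\Phi_t\}_{t\ge 0}$ be a primitive quantum Markov semigroup on $M_n(\mathbb{C})$ with generator $\mathcal{L}$ that is KMS-symmetric with respect to its faithful invariant state $\rho$. Then $$\sqrt{\frac{2}{h_\rho(\mathcal{L})}}\;\le\;\mathrm{diam}_{d_{\mathcal{L}}}\,\mathcal{S}(M_n(\mathbb{C}))\;\le\;\frac{2s_+}{s_-\,h_\rho(\mathcal{L})}\sqrt{\frac{\|\mathcal{L}\|_{\mathrm{KMS},\rho}}{s_-}}.$$
   Context: Throughout $n\ge 2$ and $M_n(\mathbb{C})$ carries the unnormalized trace $\mathrm{Tr}$. A quantum Markov semigroup is a norm-continuous semigroup $\{\Phi_t\}_{t\ge0}$ of unital completely positive linear maps on $M_n(\mathbb{C})$ with $\Phi_0=\mathrm{Id}$; its generator $\mathcal{L}$ is defined by $\Phi_t=e^{-t\mathcal{L}}$. A faithful state $\rho$ has positive definite density matrix $D_\rho$, $\rho(X)=\mathrm{Tr}(D_\rho X)$; $s_-$ and $s_+$ are the smallest and largest eigenvalues of $D_\rho$. The KMS inner product is $\langle X,Y\rangle_{\mathrm{KMS},\rho}=\mathrm{Tr}(X^*D_\rho^{1/2}YD_\rho^{1/2})$, with norm $\|X\|_{\mathrm{KMS},\rho}$; for a linear map, $\|\mathcal{L}\|_{\mathrm{KMS},\rho}=\sup_{X\ne0}\|\mathcal{L}(X)\|_{\mathrm{KMS},\rho}/\|X\|_{\mathrm{KMS},\rho}$. The semigroup is KMS-symmetric with respect to $\rho$ if $\langle X,\Phi_t(Y)\rangle_{\mathrm{KMS},\rho}=\langle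 \Phi_t(X),Y\rangle_{\mathrm{KMS},\rho}$ for all $t\ge0$ and all $X,Y$. It is primitive if it admits a faithful invariant state and $\ker\mathcal{L}=\mathbb{C}I$; $\rho$ is then the unique invariant state. Projection Dirichlet conductance: $h_\rho(\mathcal{L})=\inf_{P}\dfrac{\langle P,\mathcal{L}(P)\rangle_{\mathrm{KMS},\rho}}{\min\{\rho(P),1-\rho(P)\}}$, the infimum over all orthogonal projections $P\in M_n(\mathbb{C})$ with $P\ne0,I$. $\mathcal{S}(M_n(\mathbb{C}))$ is the set of density matrices (positive semidefinite, trace one). The distance $d_{\mathcal{L}}$ on it is $d_{\mathcal{L}}(D_1,D_2)=\sup\{|\mathrm{Tr}((D_1-D_2)X)|:\ X=X^*\in M_n(\mathbb{C}),\ \langle X,\mathcal{L}(X)\rangle_{\mathrm{KMS},\rho}\le1\}$, and $\mathrm{diam}_{d_{\mathcal{L}}}\mathcal{S}(M_n(\mathbb{C}))=\sup_{D_1,D_2}d_{\mathcal{L}}(D_1,D_2)$. *)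

(* Defs.v *)
From HB Require Import structures.
From mathcomp Require Import all_boot all_order all_algebra.
From mathcomp Require Import all_classical all_reals all_analysis.
From mathcomp Require Import sesquilinear spectral complex.

Set Implicit Arguments.
Unset Strict Implicit.
Unset Printing Implicit Defensive.

Import Order.TTheory GRing.Theory Num.Theory numFieldNormedType.Exports.

Local Open Scope classical_set_scope.
Local Open Scope ring_scope.
Local Open Scope sesquilinear_scope.
Local Open Scope complex_scope.

Section Matrices.
Context {R : realType}.

Definition psdmx m (A : 'M[R[i]]_m) : Prop :=
  A \is hermsymmx /\ forall v : 'cV[R[i]]_m, 0 <= (v ^t* *m A *m v) 0 0.

Definition posdefmx m (A : 'M[R[i]]_m) : Prop :=
  A \is hermsymmx /\
  forall v : 'cV[R[i]]_m, v != 0 -> 0 < (v ^t* *m A *m v) 0 0.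

(* The functional calculus A^{1/2} through the unitary diagonalization of A;
   meaningful for positive semidefinite A. *)
Definition sqrtmx m (A : 'M[R[i]]_m) : 'M[R[i]]_m :=
  invmx (spectralmx A) *m diag_mx (map_mx sqrtC (spectral_diag A))
  *m spectralmx A.

(* For Hermitian A with m > 0 the set below is finite and nonempty, so these
   are a minimum and a maximum. *)
Definition min_eigenvalue m (A : 'M[R[i]]_m) : R :=
  inf [set x : R | eigenvalue A x%:C].

Definition max_eigenvalue m (A : 'M[R[i]]_m) : R :=
  sup [set x : R | eigenvalue A x%:C].

Definition orthogonal_projection m (P : 'M[R[i]]_m) : Prop :=
  P \is hermsymmx /\ P *m P = P.

(* Operator norm of an endomorphism f with respect to a norm N. *)
Definition opnorm (U : zmodType) (N : U -> R) (f : U -> U) : R :=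
  sup [set N (f x) / N x | x in [set x : U | x != 0]].

Definition euclidean_norm m (v : 'cV[R[i]]_m) : R :=
  Num.sqrt (complex.Re ((v ^t* *m v) 0 0)).

Definition cstar_norm m (A : 'M[R[i]]_m) : R :=
  opnorm (@euclidean_norm m) (mulmx A).

End Matrices.

Section QuantumMarkovSemigroups.
Context {R : realType} {n : nat}.
Local Notation M := 'M[R[i]]_n.

(* M_k(M_n(C)) is identified with block matrices with k x k blocks. *)
Definition completely_positive (f : M -> M) : Prop :=
  forall k (A : 'I_k -> 'I_k -> M),
    psdmx (\mxblock_(i, j) A i j) -> psdmx (\mxblock_(i, j) f (A i j)).

(* The value of Phi at negative times is irrelevant. *)
Record quantum_markov_semigroup (Phi : R -> {linear M -> M}) : Prop := QMS {
  qms0 : forall X, Phi 0 X = X;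
  qmsD : forall s t, 0 <= s -> 0 <= t ->
    forall X, Phi (s + t) X = Phi s (Phi t X);
  qms_unital : forall t, 0 <= t -> Phi t 1%:M = 1%:M;
  qms_cp : forall t, 0 <= t -> completely_positive (Phi t);
  qms_continuous : forall t, 0 <= t ->
    opnorm (@cstar_norm R n) (fun X => Phi s X - Phi t X)
      @[s --> within [set s : R | 0 <= s] (nbhs t)] --> (0 : R)
}.

(* Phi t = exp (- t L), the exponential series converging in operator norm. *)
Definition is_generator (Phi : R -> {linear M -> M}) (L : {linear M -> M})
    : Prop :=
  forall t, 0 <= t ->
    opnorm (@cstar_norm R n) (fun X =>
        Phi t X - \sum_(k < m) ((- t) ^+ k / k`!%:R)%:C *: iter k L X)
      @[m --> \oo] --> (0 : R).

Definition density : set M := [set D | psdmx D /\ \tr D = 1].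

(* A state is represented throughout by its density matrix D. *)
Definition state (D X : M) : R[i] := \tr (D *m X).

Definition faithful_state (D : M) : Prop := posdefmx D /\ \tr D = 1.

Definition invariant_state (Phi : R -> {linear M -> M}) (D : M) : Prop :=
  forall t, 0 <= t -> forall X, state D (Phi t X) = state D X.

Definition primitive (Phi : R -> {linear M -> M}) (L : {linear M -> M})
    : Prop :=
  (exists D, faithful_state D /\ invariant_state Phi D) /\
  forall X, L X = 0 <-> is_scalar_mx X.

Definition kms (D X Y : M) : R[i] :=
  \tr (X ^t* *m sqrtmx D *m Y *m sqrtmx D).

Definition kms_norm (D X : M) : R := Num.sqrt (complex.Re (kms D X X)).

Definition kms_opnorm (D : M) (L : M -> M) : R := opnorm (kms_norm D) L.

Definition kms_symmetric (D : M) (Phi : R -> {linear M -> M}) : Prop :=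
  forall t, 0 <= t -> forall X Y, kms D X (Phi t Y) = kms D (Phi t X) Y.

(* For the KMS-symmetric generators considered here <X, L X> is real. *)
Definition dirichlet_form (D : M) (L : M -> M) (X : M) : R :=
  complex.Re (kms D X (L X)).

(* state D P is real whenever D and P are Hermitian. *)
Definition conductance (D : M) (L : M -> M) : R :=
  inf [set dirichlet_form D L P /
             Num.min (complex.Re (state D P)) (1 - complex.Re (state D P))
      | P in [set P : M | [/\ orthogonal_projection P, P != 0 & P != 1%:M]]].

(* The suprema are taken in the extended reals, so that finiteness of the
   distance and of the diameter is not presupposed. *)
Definition dist_L (D : M) (L : M -> M) (D1 D2 : M) : \bar R :=
  ereal_sup [set (complex.Re `|\tr ((D1 - D2) *m X)|)%:E
            | X in [set X : M | X \is hermsymmx /\ dirichlet_form D L X <= 1]].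

Definition diam_L (D : M) (L : M -> M) : \bar R :=
  ereal_sup [set dist_L D L D1 D2 | D1 in density & D2 in density].

End QuantumMarkovSemigroups.

(* Main.v *)
(* For a unital completely positive map Phi that is KMS-symmetric for
   D = d^2 there are matrices V_j with, for every X,
     <X, X - Phi X>_KMS = \sum_j <[V_j, X], [V_j, X]>_KMS.
   In an eigenbasis of D the Choi matrix of \sum_j V_j^* X V_j is that of Phi
   with the ((p,k),(q,l)) entry divided by d_p/d_k + d_q/d_l; this solves a
   Lyapunov equation, hence is again positive semidefinite.  KMS symmetry makes
   the family (V_j) stable under adjoints, and unitality then forces
   \sum_j V_j^* d V_j = \sum_j V_j d V_j^* = d/2.
   The KMS norm being comparable to the Hilbert-Schmidt norm with constants s_-
   and s_+, on the observables diagonal in a fixed orthonormal basis the form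
   <X, X - Phi_t X>_KMS is comparable to the energy of a weighted graph on the
   basis vectors.  Cheeger's inequality for this graph, whose isoperimetric
   constant is controlled by h and whose degrees are controlled by the KMS norm
   of L, bounds the spread of the spectrum of X; dividing by t and letting t
   tend to 0 gives the upper bound.  The lower bound is the value at a multiple
   of a projection P for two densities supported on P and on 1 - P.  Finally,
   h > 0 because X |-> L X + tr X is injective. *)
Require Import Defs.
From HB Require Import structures.
From mathcomp Require Import all_boot all_order all_algebra.
From mathcomp Require Import all_classical all_reals all_analysis.
From mathcomp Require Import sesquilinear spectral complex.
From mathcomp Require Import ring lra.

Set Implicit Arguments.
Unset Strict Implicit.
Unset Printing Implicit Defensive.

Import Order.TTheory GRing.Theory Num.Theory numFieldNormedType.Exports.
Import Num.Def.

Local Open Scope ring_scope.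
Local Open Scope sesquilinear_scope.

(** * Positive semidefinite matrices and the commutator form *)

Section Adjoint.
Context {C : numClosedFieldType}.

(** The Cheeger argument is applied to [Phi t] at fixed t > 0, where complete positivity is directly
    available; no structure theorem for generators enters. The V_j depend on t but not on X, so a
    single weighted graph serves an observable and all projections diagonal in its eigenbasis at
    once. This is why the form is written with commutators: on a commuting family it turns into
    weighted squares of eigenvalue differences. The price is that h and the norm of [L] control the
    graph only up to O(t^2). These errors are made uniform over the finitely many subsets of the
    basis and then absorbed as relative errors, because a nontrivial subset has mass at least s_-;
    only the final inequality is taken to t = 0. Constants: 4 is 2 from Cheeger times 2 from
    comparing two eigenvalues with a median. s_+ enters squared through the isoperimetric constant;
    s_-^3 collects the degrees, the energy of X and the least mass of a basis vector. In the lower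
    bound, 2 is the inverse of the bound 1/2 on min(rho(P), 1 - rho(P)). *)

Lemma trmxCE m n (A : 'M[C]_(m, n)) i j : A^t* i j = (A j i)^*.
Proof. by rewrite !mxE. Qed.

Lemma trmxC_mul m n p (A : 'M[C]_(m, n)) (B : 'M[C]_(n, p)) :
  (A *m B)^t* = B^t* *m A^t*.
Proof. by rewrite trmx_mul map_mxM. Qed.

Lemma trmxCB m n (A B : 'M[C]_(m, n)) : (A - B)^t* = A^t* - B^t*.
Proof. by rewrite linearB /= map_mxB. Qed.

Lemma trmxCZ m n a (A : 'M[C]_(m, n)) : (a *: A)^t* = a^* *: A^t*.
Proof. by rewrite linearZ /= map_mxZ. Qed.

Lemma trmxC1 n : (1%:M : 'M[C]_n)^t* = 1%:M.
Proof. by rewrite trmx1 map_mx1. Qed.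

Lemma trmxC_diag n (d : 'rV[C]_n) : (diag_mx d)^t* = diag_mx (map_mx conjC d).
Proof. by rewrite tr_diag_mx map_diag_mx. Qed.

Lemma hermP n (A : 'M[C]_n) : (A \is hermsymmx) <-> (A^t* = A).
Proof.
split=> [/is_hermitianmxP|H]; first by rewrite expr0 scale1r.
by apply/is_hermitianmxP; rewrite expr0 scale1r.
Qed.

Lemma mxtrace_adj n (A : 'M[C]_n) : \tr (A^t*) = (\tr A)^*.
Proof. by rewrite /mxtrace rmorph_sum; apply: eq_bigr => i _; rewrite trmxCE. Qed.

Lemma mxtrace_quad n (X A Y B : 'M[C]_n) :
  \tr (X^t* *m A *m Y *m B) =
  \sum_k \sum_l \sum_p \sum_q (X k l)^* * Y p q * (A k p * B q l).
Proof.
rewrite /mxtrace.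
under eq_bigr => l _.
  rewrite mxE.
  under eq_bigr => q _.
    rewrite mxE mulr_suml.
    under eq_bigr => p _.
      rewrite mxE !mulr_suml.
      under eq_bigr => k _ do rewrite trmxCE.
      over.
    over.
  over.
rewrite /=.
under eq_bigr => l _ do
  (rewrite exchange_big /=; under eq_bigr => p _ do rewrite exchange_big /=;
   rewrite exchange_big /=).
rewrite exchange_big /=.
do 4 (apply: eq_bigr => ? _); ring.
Qed.

Lemma mulmx_adj_self m (v : 'cV[C]_m) :
  (v^t* *m v) 0 0 = \sum_i `|v i 0| ^+ 2.
Proof. by rewrite mxE; apply: eq_bigr => i _; rewrite trmxCE normCK mulrC. Qed.

Lemma spectral_herm n (A : 'M[C]_n) : A^t* = A ->
  A = (spectralmx A)^t* *m diag_mx (spectral_diag A) *m spectralmx A.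
Proof.
move=> /hermP/hermitian_normalmx/orthomx_spectralP {1}->.
by rewrite invmx_unitary ?spectral_unitarymx.
Qed.

Lemma spectral_diag_real n (A : 'M[C]_n) i : A^t* = A ->
  spectral_diag A 0 i \is Num.real.
Proof. by move=> /hermP/hermitian_spectral_diag_real/mxOverP; apply. Qed.

Lemma herm_diag_sum n (P : 'M[C]_n) (mu : 'rV[C]_n) i j :
  (P^t* *m diag_mx mu *m P) i j = \sum_m mu 0 m * ((P m i)^* * P m j).
Proof.
rewrite mxE; apply: eq_bigr => m _.
by rewrite mul_mx_diag mxE trmxCE; ring.
Qed.

(* A negative eigenvalue mu of [c], with eigenvector u, would make the
   quadratic form equal to 2 mu \sum_i a i |u i|^2 < 0 at u. *)
Lemma lyapunov_gram (I : finType) (a : I -> C) (c : I -> I -> C) :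
    (forall i, 0 < a i) -> (forall i j, c j i = (c i j)^*) ->
    (forall x : I -> C,
       0 <= \sum_i \sum_j (x i)^* * ((a i + a j) * c i j) * x j) ->
  exists v : I -> I -> C, forall i j, c i j = \sum_m (v m i)^* * v m j.
Proof.
move=> a_gt0 c_herm c_psd; pose N := #|I|.
pose H : 'M[C]_N := \matrix_(i, j) c (enum_val i) (enum_val j).
have H_herm : H^t* = H by apply/matrixP => i j; rewrite trmxCE !mxE c_herm conjCK.
have HE := spectral_herm H_herm.
set P := spectralmx H in HE; set mu := spectral_diag H in HE.
have PP : P *m P^t* = 1%:M by apply/unitarymxP/spectral_unitarymx.
have mu_real m : mu 0 m \is Num.real by exact: spectral_diag_real.
have mu_ge0 m : 0 <= mu 0 m.
  pose x i := (P m (enum_rank i))^*.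
  have Hx i : \sum_j c i j * x j = mu 0 m * x i.
    have HP : H *m P^t* = P^t* *m diag_mx mu by rewrite HE -!mulmxA PP mulmx1.
    have := congr1 (fun A : 'M[C]_N => A (enum_rank i) m) HP.
    rewrite mul_mx_diag !mxE mulrC => <-.
    rewrite (reindex (fun j : 'I_N => enum_val j)) /=; last first.
      by apply: onW_bij; exact: enum_val_bij.
    by apply: eq_bigr => j _; rewrite !mxE /x enum_rankK enum_valK.
  have := c_psd x.
  have -> : \sum_i \sum_j (x i)^* * ((a i + a j) * c i j) * x j =
            2 * mu 0 m * \sum_i a i * ((x i)^* * x i).
    transitivity (\sum_i (x i)^* * a i * (\sum_j c i j * x j) +
                  \sum_j a j * x j * (\sum_i c j i * x i)^*).
      transitivity (\sum_i \sum_j ((x i)^* * a i * (c i j * x j)) +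
                    \sum_i \sum_j (a j * x j * (c j i * x i)^*)).
        rewrite -big_split; apply: eq_bigr => i _; rewrite -big_split.
        by apply: eq_bigr => j _ /=; rewrite rmorphM /= -c_herm; ring.
      congr (_ + _); last rewrite exchange_big /=.
        by apply: eq_bigr => i _; rewrite mulr_sumr.
      by apply: eq_bigr => j _; rewrite rmorph_sum /= mulr_sumr.
    rewrite mulr_sumr -big_split; apply: eq_bigr => i _ /=.
    rewrite Hx rmorphM /= (CrealP (mu_real m)); ring.
  rewrite -mulrA pmulr_rge0 ?ltr0n //.
  suff s_gt0 : 0 < \sum_i a i * ((x i)^* * x i) by rewrite pmulr_lge0.
  have t_ge0 i : 0 <= a i * ((x i)^* * x i).
    by rewrite mulr_ge0 ?(ltW (a_gt0 i)) // mulrC mul_conjC_ge0.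
  rewrite lt_neqAle sumr_ge0 // andbT; apply/eqP => /esym/psumr_eq0P s0.
  have /matrixP/(_ m m) := PP; rewrite !mxE eqxx big1 => [/eqP|j _].
    by rewrite eq_sym oner_eq0.
  have /eqP := s0 (fun i _ => t_ge0 i) (enum_val j) isT.
  rewrite !mulf_eq0 conjC_eq0 orbb (gt_eqF (a_gt0 _)) /= /x conjC_eq0.
  by rewrite enum_valK => /eqP ->; rewrite mul0r.
exists (fun m i => sqrtC (mu 0 (enum_rank m)) * P (enum_rank m) (enum_rank i)).
move=> i j.
have -> : c i j = H (enum_rank i) (enum_rank j) by rewrite mxE !enum_rankK.
rewrite HE herm_diag_sum (reindex enum_rank) /=; last first.
  by apply: onW_bij; exact: enum_rank_bij.
apply: eq_bigr => m _; rewrite rmorphM /=.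
rewrite (conj_Creal (x := sqrtC _)); last by rewrite ger0_real // sqrtC_ge0.
by rewrite -{1}[mu 0 _]sqrtCK; ring.
Qed.

Lemma mxtrace_diag_quad n (X Y : 'M[C]_n) (d e : 'rV[C]_n) :
  \tr (X^t* *m diag_mx d *m Y *m diag_mx e) =
  \sum_k \sum_l d 0 k * e 0 l * ((X k l)^* * Y k l).
Proof.
rewrite /mxtrace exchange_big /=; apply: eq_bigr => l _.
rewrite mul_mx_diag mxE mxE mulr_suml; apply: eq_bigr => k _.
by rewrite mul_mx_diag mxE trmxCE; ring.
Qed.

(** [B p q] plays the image of the matrix unit at (p, q) in an eigenbasis of the square root of the
    state: the vectors [x] test the Choi matrix, and the last hypothesis is KMS symmetry on matrix
    units. Both sides are expanded in the coefficients of X and compared term by term. *)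
Lemma symmetric_commutator_form n (d : 'rV[C]_n) (B : 'I_n -> 'I_n -> 'M[C]_n) :
    (forall k, 0 < d 0 k) ->
    (forall p q k l, B q p l k = (B p q k l)^*) ->
    (forall x : 'I_n * 'I_n -> C,
       0 <= \sum_i \sum_j (x i)^* * B i.1 j.1 i.2 j.2 * x j) ->
    \sum_p B p p = 1%:M ->
    (forall p q k l,
       d 0 k * d 0 l * B p q k l = d 0 p * d 0 q * B l k q p) ->
  exists (I : finType) (V : I -> 'M[C]_n), forall X,
    \tr (X^t* *m diag_mx d *m (X - \sum_p \sum_q X p q *: B p q) *m diag_mx d) =
    \sum_m \tr ((V m *m X - X *m V m)^t* *m diag_mx d
                *m (V m *m X - X *m V m) *m diag_mx d).
Proof.
move=> d_gt0 B_herm B_psd B_unital B_sym.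
have d_neq0 k : d 0 k != 0 by rewrite gt_eqF.
have d_conj k : (d 0 k)^* = d 0 k by apply/CrealP/gtr0_real.
pose a (i : 'I_n * 'I_n) := d 0 i.1 / d 0 i.2.
have a_gt0 i : 0 < a i by rewrite divr_gt0.
have aa_neq0 i j : a i + a j != 0 by rewrite gt_eqF // addr_gt0.
pose c (i j : 'I_n * 'I_n) := B i.1 j.1 i.2 j.2 / (a i + a j).
have [|x|v cE] := lyapunov_gram (c := c) a_gt0.
- move=> i j; rewrite /c B_herm rmorphM fmorphV rmorphD /= [a j + _]addrC.
  by rewrite !(conj_Creal (gtr0_real (a_gt0 _))).
- have := B_psd x; congr (0 <= _).
  apply: eq_bigr => i _; apply: eq_bigr => j _.
  by rewrite /c [_ * (_ / _)]mulrC divfK.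
pose V m : 'M[C]_n := \matrix_(p, q) v m (p, q).
have BE p q k l : B p q k l = (d 0 p / d 0 k + d 0 q / d 0 l) * c (p, k) (q, l).
  by rewrite /c mulrC divfK //; exact: (aa_neq0 (p, k) (q, l)).
(* The families of the [V m] and of their adjoints have the same Gram matrix. *)
have c_sym p q k l : c (p, k) (q, l) = c (l, q) (k, p).
  have := B_sym p q k l; rewrite !BE => H.
  apply: (@mulfI _ (d 0 p * d 0 l + d 0 q * d 0 k)).
    by rewrite gt_eqF // addr_gt0 // mulr_gt0.
  transitivity (d 0 k * d 0 l *
      ((d 0 p / d 0 k + d 0 q / d 0 l) * c (p, k) (q, l))).
    by field; rewrite !d_neq0.
  by rewrite H; field; rewrite !d_neq0.
have VE p k q l : \sum_m (V m p k)^* * V m q l = c (p, k) (q, l).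
  by rewrite cE; apply: eq_bigr => m _; rewrite !mxE.
(* Here B p p k l = d_p (1/d_k + 1/d_l) c (p,k) (p,l), so unitality fixes the sum; the factor 1/2
   appears at k = l. *)
have N k l : \sum_p d 0 p * c (p, k) (p, l) = d 0 k / 2 *+ (k == l).
  have /matrixP/(_ k l) := B_unital; rewrite summxE mxE => H.
  apply: (@mulfI _ ((d 0 k)^-1 + (d 0 l)^-1)).
    by rewrite gt_eqF // addr_gt0 // invr_gt0.
  rewrite mulr_sumr.
  transitivity ((k == l)%:R : C).
    by rewrite -H; apply: eq_bigr => p _; rewrite BE; ring.
  by case: eqP => [->|_]; rewrite ?mulr1n ?mulr0n ?mulr0 //; field; rewrite d_neq0.
have N1 k p : \sum_m ((V m)^t* *m diag_mx d *m V m) k p = d 0 k / 2 *+ (k == p).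
  under eq_bigr => m _ do rewrite mxE.
  rewrite exchange_big /= -N; apply: eq_bigr => r _.
  rewrite -VE mulr_sumr; apply: eq_bigr => m _.
  by rewrite mul_mx_diag mxE trmxCE; ring.
have N2 q l : \sum_m (V m *m diag_mx d *m (V m)^t*) q l = d 0 q / 2 *+ (q == l).
  under eq_bigr => m _ do rewrite mxE.
  rewrite exchange_big /= -N; apply: eq_bigr => r _.
  rewrite -c_sym -VE mulr_sumr; apply: eq_bigr => m _.
  by rewrite mul_mx_diag mxE trmxCE; ring.
have trB (P Q : 'M[C]_n) : \tr (P - Q) = \tr P - \tr Q by rewrite linearB.
exists [the finType of ('I_n * 'I_n)%type], V => X; set D := diag_mx d.
transitivity (\sum_m
   (\tr (X^t* *m ((V m)^t* *m D *m V m) *m X *m D)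
    - \tr (X^t* *m ((V m)^t* *m D) *m X *m (V m *m D))
    - \tr (X^t* *m (D *m V m) *m X *m (D *m (V m)^t*))
    + \tr (X^t* *m D *m X *m (V m *m D *m (V m)^t*)))); last first.
  apply: eq_bigr => m _; rewrite trmxCB !trmxC_mul !(mulmxBl, mulmxBr) !trB !mulmxA.
  have rot (P Q : 'M[C]_n) : \tr (P *m Q *m (V m)^t*) = \tr ((V m)^t* *m P *m Q).
    by rewrite mxtrace_mulC mulmxA.
  by rewrite !rot !mulmxA; ring.
rewrite mulmxBr mulmxBl trB.
transitivity (\sum_k \sum_l \sum_p \sum_q (X k l)^* * X p q *
    (D k p * D q l - d 0 k * d 0 l * B p q k l)).
  rewrite mxtrace_quad mxtrace_diag_quad -sumrB; apply: eq_bigr => k _.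
  rewrite -sumrB; apply: eq_bigr => l _.
  rewrite summxE mulr_sumr mulr_sumr -sumrB; apply: eq_bigr => p _.
  rewrite summxE mulr_sumr mulr_sumr -sumrB; apply: eq_bigr => q _.
  have -> : (X p q *: B p q) k l = X p q * B p q k l by rewrite mxE.
  by ring.
rewrite big_split !sumrB /=.
have quad A E : \sum_m \tr (X^t* *m A m *m X *m E m) =
    \sum_k \sum_l \sum_p \sum_q (X k l)^* * X p q *
      (\sum_(m : 'I_n * 'I_n) A m k p * E m q l).
  under eq_bigr => m _ do rewrite mxtrace_quad.
  do 4 (rewrite exchange_big /=; apply: eq_bigr => ? _).
  by rewrite mulr_sumr.
rewrite !quad -!sumrB -big_split; apply: eq_bigr => k _.
rewrite -!sumrB -big_split; apply: eq_bigr => l _.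
rewrite -!sumrB -big_split; apply: eq_bigr => p _.
rewrite -!sumrB -big_split; apply: eq_bigr => q _ /=.
rewrite -!mulrBr -mulrDr; congr (_ * _).
(* The two outer terms of the expanded commutator form contribute one half of the diagonal part
   each. The two cross terms restore B, since d_k d_l B p q k l = (d_p d_l + d_k d_q) c (p,k)
   (q,l). *)
rewrite -mulr_suml -mulr_sumr N1 N2.
have -> : \sum_m (((V m)^t* *m D) k p * (V m *m D) q l) =
          d 0 p * d 0 l * c (p, k) (q, l).
  rewrite -VE mulr_sumr; apply: eq_bigr => m _.
  by rewrite !mul_mx_diag !mxE; ring.
have -> : \sum_m ((D *m V m) k p * (D *m (V m)^t*) q l) =
          d 0 k * d 0 q * c (p, k) (q, l).
  rewrite c_sym -VE mulr_sumr; apply: eq_bigr => m _.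
  by rewrite !mul_diag_mx !mxE; ring.
rewrite !mxE BE.
by case: (k == p); case: (q == l); rewrite ?mulr1n ?mulr0n; field; rewrite !d_neq0.
Qed.

End Adjoint.

(** * The weighted form tr (X^* S Y S) in an eigenbasis of S *)

Section WeightedForm.
Context {C : numClosedFieldType} {n : nat}.
Local Notation M := 'M[C]_n.

Definition wform (S X Y : M) : C := \tr (X^t* *m S *m Y *m S).

(** Positive semidefiniteness of the block matrix with blocks [A p q], stated on block vectors so
    that no flattened index occurs; [psd_mxblockP] is the translation. *)
Definition psd_blocks k (A : 'I_k -> 'I_k -> M) : Prop :=
  (forall p q, A q p = (A p q)^t*) /\
  (forall v : 'I_k -> 'cV[C]_n,
     0 <= \sum_p \sum_q ((v p)^t* *m A p q *m v q) 0 0).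

Definition hs_norm2 (X : M) : C := \sum_i \sum_j `|X i j| ^+ 2.

Lemma hs_norm2E X : hs_norm2 X = \tr (X^t* *m X).
Proof.
rewrite /hs_norm2 exchange_big /mxtrace; apply: eq_bigr => j _.
by rewrite mxE; apply: eq_bigr => i _; rewrite trmxCE normCK mulrC.
Qed.

Lemma hs_norm2_unitary U X : U \is unitarymx ->
  hs_norm2 (U *m X *m U^t*) = hs_norm2 X.
Proof.
move=> U_unitary; rewrite !hs_norm2E !trmxC_mul trmxCK.
have UtU : U^t* *m U = 1%:M by rewrite -invmx_unitary // mulVmx ?unitarymx_unit.
by rewrite !mulmxA mxtrace_mulC !mulmxA UtU mul1mx -(mulmxA (X^t*)) UtU mulmx1.
Qed.

Section Diagonalized.
Variables (S U : M) (d : 'rV[C]_n).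
Hypothesis U_unitary : U \is unitarymx.
Hypothesis d_gt0 : forall k, 0 < d 0 k.
Hypothesis SE : S = U^t* *m diag_mx d *m U.

Local Lemma UUt : U *m U^t* = 1%:M.
Proof. exact/unitarymxP. Qed.

Local Lemma UtU : U^t* *m U = 1%:M.
Proof. by rewrite -invmx_unitary // mulVmx ?unitarymx_unit. Qed.

Definition eigen_coord (X : M) : M := U *m X *m U^t*.

Lemma eigen_coordM X Y : eigen_coord (X *m Y) = eigen_coord X *m eigen_coord Y.
Proof. by rewrite /eigen_coord !mulmxA mulmxKtV. Qed.

Lemma eigen_coordB X Y : eigen_coord (X - Y) = eigen_coord X - eigen_coord Y.
Proof. by rewrite /eigen_coord mulmxBr mulmxBl. Qed.

Lemma eigen_coord_adj X : eigen_coord (X^t*) = (eigen_coord X)^t*.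
Proof. by rewrite /eigen_coord !trmxC_mul trmxCK mulmxA. Qed.

Lemma wform_diag X Y :
  wform S X Y = \tr ((eigen_coord X)^t* *m diag_mx d
                   *m eigen_coord Y *m diag_mx d).
Proof.
rewrite /wform SE -eigen_coord_adj /eigen_coord !mulmxA.
by rewrite mxtrace_mulC !mulmxA.
Qed.

Lemma wform_sumE X Y : wform S X Y = \sum_k \sum_l d 0 k * d 0 l *
   ((eigen_coord X k l)^* * eigen_coord Y k l).
Proof. by rewrite wform_diag mxtrace_diag_quad. Qed.

(** Complete positivity, unitality and symmetry, tested on the matrix units of the eigenbasis of S,
    are the hypotheses of [symmetric_commutator_form]. *)
Lemma qms_commutator_form (Phi : {linear M -> M}) :
    (forall k (A : 'I_k -> 'I_k -> M),
       psd_blocks A -> psd_blocks (fun p q => Phi (A p q))) -> Phi 1%:M = 1%:M ->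
    (forall X Y, wform S X (Phi Y) = wform S (Phi X) Y) ->
  exists (I : finType) (V : I -> M), forall X,
    wform S X (X - Phi X) =
    \sum_m wform S (V m *m X - X *m V m) (V m *m X - X *m V m).
Proof.
move=> cp unital sym.
have delta_quad (x : 'rV[C]_n) (y : 'cV[C]_n) p q :
    (x *m delta_mx p q *m y) 0 0 = x 0 p * y q 0.
  rewrite -(mul_delta_mx (0 : 'I_1)) mulmxA -mulmxA -colE -rowE mxE big_ord1.
  by rewrite !mxE.
pose E p q : M := U^t* *m delta_mx p q *m U.
have E_adj p q : E q p = (E p q)^t*.
  rewrite /E !trmxC_mul trmxCK mulmxA; congr (_ *m _ *m _).
  by apply/matrixP => i j; rewrite !mxE rmorph_nat andbC.
have : psd_blocks E.
  split=> // v.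
  (* The block matrix of all matrix units has rank one, so its quadratic form is a squared
     modulus. *)
  have -> : \sum_p \sum_q ((v p)^t* *m E p q *m v q) 0 0 =
            (\sum_p (U *m v p) p 0)^* * (\sum_q (U *m v q) q 0).
    rewrite rmorph_sum mulr_suml; apply: eq_bigr => p _.
    rewrite mulr_sumr; apply: eq_bigr => q _ /=.
    by rewrite /E !mulmxA -trmxC_mul -mulmxA delta_quad trmxCE.
  by rewrite mulrC mul_conjC_ge0.
move=> /cp[Phi_adj Phi_psd].
pose B p q := eigen_coord (Phi (E p q)).
have coordK X : X = U^t* *m eigen_coord X *m U.
  by rewrite /eigen_coord -!mulmxA UtU mulmx1 mulmxA UtU mul1mx.
have coordKV X : eigen_coord (U^t* *m X *m U) = X.
  by rewrite /eigen_coord -!mulmxA UUt mulmx1 mulmxA UUt mul1mx.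
have PhiE X : eigen_coord (Phi X) = \sum_p \sum_q eigen_coord X p q *: B p q.
  rewrite {1}[X]coordK {1}[eigen_coord X]matrix_sum_delta.
  rewrite mulmx_sumr mulmx_suml linear_sum /eigen_coord mulmx_sumr mulmx_suml.
  apply: eq_bigr => p _.
  rewrite mulmx_sumr mulmx_suml linear_sum /eigen_coord mulmx_sumr mulmx_suml.
  apply: eq_bigr => q _.
  by rewrite -scalemxAr -scalemxAl linearZ -scalemxAr -scalemxAl.
have wform_delta p q X :
    wform S (E p q) X = d 0 p * d 0 q * eigen_coord X p q.
  rewrite wform_sumE (bigD1 p) //= [X in _ + X]big1 ?addr0 => [|i ip]; last first.
    rewrite big1 // => j _.
    by rewrite coordKV [delta_mx _ _ _ _]mxE (negPf ip) conjC0 mul0r mulr0.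
  rewrite (bigD1 q) //= big1 ?addr0 => [|j jq]; last first.
    by rewrite coordKV [delta_mx _ _ _ _]mxE (negPf jq) andbF conjC0 mul0r mulr0.
  by rewrite coordKV [delta_mx _ _ _ _]mxE !eqxx conjC1 mul1r.
have wform_delta_r p q X :
    wform S X (E p q) = d 0 p * d 0 q * (eigen_coord X p q)^*.
  rewrite wform_sumE (bigD1 p) //= [X in _ + X]big1 ?addr0 => [|i ip]; last first.
    by rewrite big1 // => j _; rewrite coordKV [delta_mx _ _ _ _]mxE (negPf ip) !mulr0.
  rewrite (bigD1 q) //= big1 ?addr0 => [|j jq]; last first.
    by rewrite coordKV [delta_mx _ _ _ _]mxE (negPf jq) andbF !mulr0.
  by rewrite coordKV [delta_mx _ _ _ _]mxE !eqxx mulr1.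
have B_adj p q : B q p = (B p q)^t* by rewrite /B Phi_adj eigen_coord_adj.
have [|||||I [V VE]] := @symmetric_commutator_form C n d B.
- exact: d_gt0.
- by move=> p q k l; rewrite B_adj trmxCE.
(* The p-th block of the test vector has eigenbasis coordinates x (p, k). *)
- move=> x; have := Phi_psd (fun p => U^t* *m \col_k x (p, k)).
  congr (0 <= _).
  transitivity (\sum_p \sum_k \sum_q \sum_l (x (p, k))^* * B p q k l * x (q, l)).
    apply: eq_bigr => p _; rewrite exchange_big /=; apply: eq_bigr => q _.
    rewrite trmxC_mul trmxCK.
    rewrite (_ : _ *m _ = (\col_k x (p, k))^t* *m B p q *m \col_k x (q, k)); last first.
      by rewrite /B /eigen_coord !mulmxA.
    rewrite mxE [RHS]exchange_big; apply: eq_bigr => l _ /=.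
    rewrite [(_ *m B p q) 0 l]mxE mulr_suml; apply: eq_bigr => k _.
    by rewrite trmxCE ![(\col_ _ _) _ _]mxE.
  rewrite pair_bigA; apply: eq_bigr => -[p k] _.
  by rewrite pair_bigA; apply: eq_bigr => -[q l] _.
- have coord1 : eigen_coord 1%:M = 1%:M by rewrite /eigen_coord mulmx1 UUt.
  rewrite -[RHS]coord1 -[in RHS]unital PhiE coord1; apply: eq_bigr => p _.
  rewrite (bigD1 p) //= big1 ?addr0 => [|q qp].
    by rewrite mxE eqxx scale1r.
  by rewrite mxE eq_sym (negPf qp) scale0r.
- move=> p q k l.
  have := sym (E k l) (E p q); rewrite wform_delta wform_delta_r -/(B p q) -/(B k l).
  by move=> ->; rewrite -trmxCE -B_adj.
exists I, (fun m => U^t* *m V m *m U) => X.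
rewrite wform_diag eigen_coordB PhiE VE; apply: eq_bigr => m _.
by rewrite wform_diag eigen_coordB (eigen_coordM (_ *m U)) (eigen_coordM X) coordKV.
Qed.

Lemma wform_norm X :
  wform S X X = \sum_k \sum_l d 0 k * d 0 l * `|eigen_coord X k l| ^+ 2.
Proof.
rewrite wform_sumE; apply: eq_bigr => k _; apply: eq_bigr => l _.
by rewrite normCK [_^* * _]mulrC.
Qed.

Lemma hs_le_wform s X : (forall k l, s <= d 0 k * d 0 l) ->
  s * hs_norm2 X <= wform S X X.
Proof.
move=> s_le; rewrite -(hs_norm2_unitary X U_unitary) wform_norm mulr_sumr.
apply: ler_sum => k _; rewrite mulr_sumr; apply: ler_sum => l _.
by rewrite ler_wpM2r ?exprn_ge0.
Qed.

Lemma wform_le_hs s X : (forall k l, d 0 k * d 0 l <= s) ->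
  wform S X X <= s * hs_norm2 X.
Proof.
move=> s_ge; rewrite -(hs_norm2_unitary X U_unitary) wform_norm mulr_sumr.
apply: ler_sum => k _; rewrite mulr_sumr; apply: ler_sum => l _.
by rewrite ler_wpM2r ?exprn_ge0.
Qed.

(** In the basis W the matrix X is diagonal, and the (a, b) entry of the commutator is that of V
    times x_b - x_a. *)
Lemma hs_norm2_commutator (W V : M) (x : 'rV[C]_n) : W \is unitarymx ->
  let X := W^t* *m diag_mx x *m W in
  hs_norm2 (V *m X - X *m V) =
  \sum_a \sum_b `|(W *m V *m W^t*) a b| ^+ 2 * `|x 0 a - x 0 b| ^+ 2.
Proof.
move=> W_unitary X; rewrite -(hs_norm2_unitary _ W_unitary).
have -> : W *m (V *m X - X *m V) *m W^t* =
    (W *m V *m W^t*) *m diag_mx x - diag_mx x *m (W *m V *m W^t*).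
  have WW : W *m W^t* = 1%:M by exact/unitarymxP.
  rewrite mulmxBr mulmxBl /X !mulmxA WW mul1mx; congr (_ - _).
  by rewrite -!mulmxA WW mulmx1.
move: (W *m V *m W^t*) => A; apply: eq_bigr => a _; apply: eq_bigr => b _.
rewrite mul_mx_diag mul_diag_mx !mxE [x 0 a * _]mulrC -mulrBr normrM exprMn.
by rewrite distrC.
Qed.

(** The [V m] are produced before x is chosen, so the weights depend on [Phi] and W only. The bounds
    on d_k d_l replace the weighted norm of each commutator by its Hilbert-Schmidt norm. *)
Lemma spectral_comparison (Phi : {linear M -> M}) (W : M) (sm sp : C) :
    (forall k (A : 'I_k -> 'I_k -> M),
       psd_blocks A -> psd_blocks (fun p q => Phi (A p q))) ->
    Phi 1%:M = 1%:M -> (forall X Y, wform S X (Phi Y) = wform S (Phi X) Y) ->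
    W \is unitarymx -> (forall k l, sm <= d 0 k * d 0 l <= sp) ->
  exists c : 'I_n -> 'I_n -> C,
    [/\ forall a b, 0 <= c a b, forall a, c a a = 0 &
      forall x : 'rV[C]_n, let X := W^t* *m diag_mx x *m W in
      let T := \sum_a \sum_b c a b * `|x 0 a - x 0 b| ^+ 2 in
      sm * T <= wform S X (X - Phi X) <= sp * T].
Proof.
move=> cp unital sym W_unitary s_bnd.
have [I [V VE]] := qms_commutator_form cp unital sym.
(* Diagonal weights only multiply vanishing differences, so they are set to 0. *)
exists (fun a b => if a == b then 0 else \sum_m `|(W *m V m *m W^t*) a b| ^+ 2).
split=> [a b|a|x]; [|by rewrite eqxx|].
  by case: eqP => // _; apply: sumr_ge0 => m _; rewrite exprn_ge0.
cbv zeta; set X := (W^t* *m _ *m W); set T := \sum_a _.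
have -> : T = \sum_m hs_norm2 (V m *m X - X *m V m).
  under [RHS]eq_bigr => m _ do rewrite hs_norm2_commutator //.
  rewrite [RHS]exchange_big; apply: eq_bigr => a _ /=.
  rewrite [RHS]exchange_big; apply: eq_bigr => b _ /=.
  case: eqP => [->|_]; last by rewrite mulr_suml.
  by rewrite mul0r subrr normr0 big1 // => m _; rewrite expr0n mulr0.
rewrite VE !mulr_sumr; apply/andP; split; apply: ler_sum => m _.
  by apply: hs_le_wform => k l; case/andP: (s_bnd k l).
by apply: wform_le_hs => k l; case/andP: (s_bnd k l).
Qed.

End Diagonalized.
End WeightedForm.

(** * Positive definite matrices *)

Section PositiveDefinite.
Context {C : numClosedFieldType} {n : nat}.
Local Notation M := 'M[C]_n.

Lemma unitarymxV (U : M) : U \is unitarymx -> U^t* *m U = 1%:M.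
Proof. by move=> Uu; rewrite -invmx_unitary // mulVmx ?unitarymx_unit. Qed.

Lemma adj_mul_diag (U : M) (e : 'rV[C]_n) : (forall k, e 0 k \is Num.real) ->
  (U^t* *m diag_mx e *m U)^t* = U^t* *m diag_mx e *m U.
Proof.
move=> e_real; rewrite !trmxC_mul trmxCK trmxC_diag mulmxA.
by congr (_ *m diag_mx _ *m _); apply/rowP => k; rewrite mxE; apply/CrealP.
Qed.

Lemma hs_norm2_ge0 (X : M) : 0 <= hs_norm2 X.
Proof. by do 2 (apply: sumr_ge0 => ? _); rewrite exprn_ge0. Qed.

Lemma hs_norm2_proj (P Y : M) : P^t* = P -> P *m P = P ->
  hs_norm2 Y = hs_norm2 (P *m Y) + hs_norm2 ((1%:M - P) *m Y).
Proof.
move=> P_herm PP.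
have key (Q : M) : Q^t* = Q -> Q *m Q = Q -> hs_norm2 (Q *m Y) = \tr (Y^t* *m Q *m Y).
  by move=> Qh QQ; rewrite hs_norm2E trmxC_mul Qh mulmxA -(mulmxA _ Q Q) QQ.
have Qh : (1%:M - P)^t* = 1%:M - P by rewrite trmxCB trmxC1 P_herm.
have QQ : (1%:M - P) *m (1%:M - P) = 1%:M - P.
  by rewrite mulmxBl !mulmxBr !mul1mx !mulmx1 PP subrr subr0.
rewrite (key P) // (key (1%:M - P)) // hs_norm2E.
by rewrite -mxtraceD -mulmxDl -mulmxDr addrC subrK mulmx1.
Qed.

(** The left side is the squared Hilbert-Schmidt norm of P S P and the right side that of S P;
    compression by P does not increase it. With S the square root of the state this reads <P, P>_KMS
    <= rho(P). *)
Lemma wform_proj_le (S P : M) : S^t* = S -> P^t* = P -> P *m P = P ->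
  wform S P P <= \tr (S *m S *m P).
Proof.
move=> S_herm P_herm PP.
have -> : wform S P P = hs_norm2 (P *m (S *m P)).
  rewrite hs_norm2E !trmxC_mul P_herm S_herm /wform P_herm.
  by rewrite !mulmxA -(mulmxA (P *m S) P P) PP [RHS]mxtrace_mulC !mulmxA PP.
have -> : \tr (S *m S *m P) = hs_norm2 (S *m P).
  rewrite hs_norm2E trmxC_mul P_herm S_herm -[in LHS]PP mulmxA mxtrace_mulC.
  by rewrite !mulmxA.
by rewrite (hs_norm2_proj (S *m P) P_herm PP) lerDl hs_norm2_ge0.
Qed.

Lemma wform_conj (S X Y : M) : S^t* = S -> wform S Y X = (wform S X Y)^*.
Proof.
move=> S_herm; rewrite /wform -mxtrace_adj !trmxC_mul trmxCK S_herm !mulmxA.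
by rewrite [LHS]mxtrace_mulC !mulmxA.
Qed.

Lemma mxtrace_diag_conj (A W : M) (x : 'rV[C]_n) :
  \tr (A *m (W^t* *m diag_mx x *m W)) = \sum_a (W *m A *m W^t*) a a * x 0 a.
Proof.
rewrite !mulmxA mxtrace_mulC !mulmxA /mxtrace; apply: eq_bigr => a _.
by rewrite mul_mx_diag mxE.
Qed.

Lemma diag_conj_quad (A W : M) k : (W *m A *m W^t*) k k =
  ((col k (W^t*))^t* *m A *m col k (W^t*)) 0 0.
Proof.
have -> : (col k (W^t*))^t* = row k W.
  by rewrite -[RHS]trmxCK; apply/matrixP => i j; rewrite !mxE.
by rewrite [in LHS]mxE -row_mul mxE; apply: eq_bigr => j _; rewrite !mxE.
Qed.

Variable D : M.
Hypothesis D_herm : D^t* = D.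
Hypothesis D_pos : forall v : 'cV[C]_n, v != 0 -> 0 < (v^t* *m D *m v) 0 0.
Local Notation U := (spectralmx D).
Local Notation s := (spectral_diag D).

Lemma spectral_diagE : U *m D *m U^t* = diag_mx s.
Proof.
have UU : U *m U^t* = 1%:M by exact/unitarymxP/spectral_unitarymx.
move: UU; have := spectral_herm D_herm; set P := spectralmx D; set e := spectral_diag D.
by move=> DE PP; rewrite DE -!mulmxA PP mulmx1 mulmxA PP mul1mx.
Qed.

Lemma posdef_diag_gt0 (W : M) k : W \is unitarymx -> 0 < (W *m D *m W^t*) k k.
Proof.
move=> /unitarymxP WW; rewrite diag_conj_quad; apply: D_pos.
apply/eqP => col0; have /matrixP/(_ k k) := WW.
rewrite mxE big1 => [/eqP|j _]; first by rewrite mxE eqxx eq_sym oner_eq0.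
have /colP/(_ j) := col0; rewrite !mxE => /eqP; rewrite conjC_eq0 => /eqP ->.
by rewrite mul0r.
Qed.

Lemma spectral_diag_gt0 k : 0 < s 0 k.
Proof.
have := posdef_diag_gt0 k (spectral_unitarymx D).
by rewrite spectral_diagE mxE eqxx mulr1n.
Qed.

Lemma eigenvalue_spectral_diag x : eigenvalue D x <-> exists k, x = s 0 k.
Proof.
have UU : U *m U^t* = 1%:M by exact/unitarymxP/spectral_unitarymx.
have UV := unitarymxV (spectral_unitarymx D).
move: UU UV; have := spectral_diagE; set P := spectralmx D; set e := spectral_diag D.
move=> E PP PV; split=> [/eigenvalueP[v vD v0]|[k ->]].
  have := congr1 (fun u => u *m P^t*) vD; rewrite -scalemxAl => vDP.
  have {}vDP : v *m P^t* *m diag_mx e = x *: (v *m P^t*).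
    by rewrite -E !mulmxA -(mulmxA _ (P^t*) P) PV mulmx1.
  have /rV0Pn[k vk] : v *m P^t* != 0.
    by apply: contra v0 => /eqP v0; rewrite -[v]mulmx1 -PV mulmxA v0 mul0mx.
  exists k; have /rowP/(_ k) := vDP; rewrite mul_mx_diag mxE [RHS]mxE mulrC.
  by move/(mulIf vk).
apply/eigenvalueP; exists (row k P).
  have PD : P *m D = diag_mx e *m P by rewrite -E -(mulmxA _ (P^t*) P) PV mulmx1.
  by rewrite -row_mul PD mul_diag_mx; apply/rowP => j; rewrite !mxE.
apply/eqP => row0; have /matrixP/(_ k k) := PP.
rewrite mxE big1 => [/eqP|j _]; first by rewrite mxE eqxx eq_sym oner_eq0.
by have /rowP/(_ j) := row0; rewrite !mxE => ->; rewrite mul0r.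
Qed.

Definition sqrt_diag : 'rV[C]_n := map_mx sqrtC s.

Lemma sqrt_diag_gt0 k : 0 < sqrt_diag 0 k.
Proof. by rewrite mxE sqrtC_gt0 spectral_diag_gt0. Qed.

Lemma sqrt_diag_sqr (S : M) : S = U^t* *m diag_mx sqrt_diag *m U -> S *m S = D.
Proof.
have UU : U *m U^t* = 1%:M by exact/unitarymxP/spectral_unitarymx.
have := spectral_herm D_herm; move: UU.
rewrite /sqrt_diag; set P := spectralmx D; set e := spectral_diag D.
move=> PP -> ->; rewrite -!mulmxA (mulmxA P) PP mul1mx (mulmxA (diag_mx _)).
congr (_ *m (_ *m _)); rewrite mulmx_diag; congr diag_mx; apply/rowP => k.
by rewrite !mxE -expr2 sqrtCK.
Qed.

Lemma sqrt_diag_mul_bounds (x y : C) : 0 <= x ->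
  (forall k, x <= s 0 k <= y) -> forall k l, x <= sqrt_diag 0 k * sqrt_diag 0 l <= y.
Proof.
move=> x_ge0 xy k l.
have [/andP[xk ky] /andP[xl ly]] := (xy k, xy l).
have y_ge0 : 0 <= y := le_trans x_ge0 (le_trans xk ky).
have s_ge0 j : 0 <= s 0 j by exact/ltW/spectral_diag_gt0.
rewrite !mxE -[x]sqrtCK -[y]sqrtCK !expr2.
by apply/andP; split; apply: ler_pM; rewrite ?sqrtC_ge0 ?ler_sqrtC ?nnegrE.
Qed.

(** A diagonal entry in any orthonormal basis is an average of the eigenvalues, with weights the
    squared moduli of a row of the unitary Q. *)
Lemma posdef_diag_ge (W : M) x k : W \is unitarymx ->
  (forall j, x <= s 0 j) -> x <= (W *m D *m W^t*) k k.
Proof.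
move=> Wu x_le; pose Q := W *m U^t*.
have /unitarymxP QQ : Q \is unitarymx.
  by rewrite mul_unitarymx // trmxC_unitary spectral_unitarymx.
have -> : W *m D *m W^t* = Q *m diag_mx s *m Q^t*.
  rewrite /Q trmxC_mul trmxCK -spectral_diagE !mulmxA -(mulmxA _ _ U).
  rewrite unitarymxV ?spectral_unitarymx // mulmx1.
  by rewrite -(mulmxA _ _ U) unitarymxV ?spectral_unitarymx // mulmx1.
have -> : x = \sum_j x * (Q k j * (Q k j)^*).
  have /matrixP/(_ k k) := QQ; rewrite [LHS]mxE [RHS]mxE eqxx mulr1n => H.
  rewrite -mulr_sumr -[LHS]mulr1 -H; congr (_ * _); apply: eq_bigr => j _.
  by rewrite trmxCE.
rewrite mxE; apply: ler_sum => j _; rewrite mul_mx_diag mxE trmxCE.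
by rewrite mulrAC [_ * s 0 j]mulrC ler_wpM2r ?mul_conjC_ge0.
Qed.

End PositiveDefinite.

(** * Cheeger's inequality on a weighted graph *)

Section WeightedGraph.
Context {R : realFieldType} {I : finType}.
Implicit Types (w : I -> I -> R) (f g p : I -> R) (S : {set I}).

Definition graph_energy w f := \sum_a \sum_b w a b * (f a - f b) ^+ 2.

Definition set_indicator S a : R := (a \in S)%:R.

(* Induction on the support S of g: subtracting from g its least value m on S
   lowers both sides by the inequality for S, scaled by m. *)
Lemma coarea w p kappa g : (forall a b, 0 <= w a b) -> (forall a, 0 <= g a) ->
    (forall S, S \subset [set a | 0 < g a] ->
       kappa * \sum_(a in S) p a <= graph_energy w (set_indicator S)) ->
  kappa * (\sum_a p a * g a) <= \sum_a \sum_b w a b * `|g a - g b|.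
Proof.
move=> w_ge0; have [k] := ubnP #|[set a | 0 < g a]|.
elim: k g => // k IHk g; set S := [set a | 0 < g a]; rewrite ltnS.
move=> leSk g_ge0 iso.
have inS a : (a \in S) = (0 < g a) by rewrite inE.
have g_out a : a \notin S -> g a = 0.
  by rewrite inS -leNgt => ga_le0; apply/eqP; rewrite eq_le ga_le0 g_ge0.
have [S0|[a0 a0S]] := set_0Vmem S.
  rewrite big1 ?mulr0 => [|a _]; last by rewrite g_out ?mulr0 // S0 inE.
  by do 2 (apply: sumr_ge0 => ? _); rewrite mulr_ge0.
case: (arg_minP g a0S) => {a0S}a0 a0S a0_min; set m := g a0 in a0_min.
have m_gt0 : 0 < m by rewrite -inS.
pose g' a := g a - m * set_indicator S a.
have g'E a : g' a = if a \in S then g a - m else 0.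
  rewrite /g' /set_indicator.
  by case: ifPn => [_|/g_out ->]; rewrite ?mulr1 ?mulr0 ?subr0.
have g'_ge0 a : 0 <= g' a.
  by rewrite g'E; case: ifPn => // aS; rewrite subr_ge0 a0_min.
have sub : [set a | 0 < g' a] \subset S :\ a0.
  apply/fintype.subsetP => a; rewrite !inE g'E.
  case: ifPn => [aS ga|_]; last by rewrite ltxx.
  rewrite -inS aS andbT; apply: contraTneq ga => ->; by rewrite subrr ltxx.
have {}IHk : kappa * (\sum_a p a * g' a) <= \sum_a \sum_b w a b * `|g' a - g' b|.
  apply: IHk => //.
    apply: leq_ltn_trans (subset_leq_card sub) _.
    by apply: leq_trans leSk; apply: proper_card; apply: properD1.
  move=> T TS; apply: iso; apply: fintype.subset_trans TS _.
  exact: fintype.subset_trans sub (subsetDl _ _).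
have -> : \sum_a p a * g a = \sum_a p a * g' a + m * \sum_(a in S) p a.
  rewrite [X in m * X]big_mkcond mulr_sumr -big_split; apply: eq_bigr => a _ /=.
  by rewrite /g' /set_indicator; case: ifP => _ /=; ring.
have -> : \sum_a \sum_b w a b * `|g a - g b| =
    \sum_a \sum_b w a b * `|g' a - g' b| + m * graph_energy w (set_indicator S).
  rewrite mulr_sumr -big_split; apply: eq_bigr => a _ /=.
  rewrite mulr_sumr -big_split; apply: eq_bigr => b _ /=.
  rewrite !g'E /set_indicator.
  have [aS|/g_out ->] := boolP (a \in S); have [bS|/g_out ->] := boolP (b \in S).
  - by rewrite (_ : g a - m - _ = g a - g b) ?subrr; ring.
  - rewrite !subr0 !ger0_norm ?g_ge0 ?subr_ge0 ?a0_min //=; ring.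
  - rewrite !sub0r !normrN !ger0_norm ?g_ge0 ?subr_ge0 ?a0_min //=; ring.
  - by rewrite !subrr normr0; ring.
rewrite mulrDr lerD // mulrCA ler_pM2l // iso //.
Qed.

(** The median is the least value of f whose closed lower level set has mass at least 1/2. *)
Lemma weighted_median p f : (forall a, 0 <= p a) -> \sum_a p a = 1 ->
  exists m, \sum_(a | m < f a) p a <= 1 / 2 /\ \sum_(a | f a < m) p a <= 1 / 2.
Proof.
move=> p_ge0 p1.
pose Q a := 1 / 2 <= \sum_(b | f b <= f a) p b.
have [x0 _|no] := pickP (@predT I); last first.
  move: p1; rewrite big_pred0 => [/eqP|a]; first by rewrite eq_sym oner_eq0.
  by have := no a.
have Qx : exists a, Q a.
  case: (arg_maxP f (erefl (xpredT x0))) => a _ a_max; exists a.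
  rewrite /Q (eq_bigl xpredT) => [|b]; last by apply: a_max.
  rewrite p1; lra.
case: Qx => a1 Qa1; case: (arg_minP f Qa1) => a0 Qa0 a0_min.
exists (f a0); split.
  have := Qa0; rewrite /Q.
  have := p1; rewrite (bigID (fun b => f b <= f a0)) /=.
  under [X in _ + X]eq_bigl => b do rewrite -ltNge.
  lra.
rewrite leNgt; apply/negP => Hlt.
have [b0 b0lt|none] := pickP (fun b => f b < f a0); last first.
  by move: Hlt; rewrite big_pred0 //; lra.
(* If the mass strictly below f a0 exceeded 1/2, the largest value of f below f a0 would already
   have a closed lower level set that heavy, against minimality. *)
case: (arg_maxP f (P := fun b => f b < f a0) b0lt) => {b0lt}b0 b0lt b0_max.
have := b0lt; rewrite ltNge => /negP; apply; apply: a0_min.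
apply: le_trans (ltW Hlt) _.
rewrite [X in _ <= X](bigID (fun b => f b < f a0)) /=.
rewrite (eq_bigl (fun b => (f b <= f b0) && (f b < f a0))).
  by rewrite lerDl sumr_ge0.
by move=> b /=; have [/b0_max|_] := ltP (f b) (f a0); [move=> /= -> | rewrite andbF].
Qed.

(** For x and y of equal sign one summand vanishes and equality holds; for opposite signs the left
    side is x^2 + y^2 and the right side is the square of |x| + |y|. Treating both parts together
    loses no factor 2. *)
Lemma pos_neg_sqr (x y : R) :
  `|Num.max x 0 ^+ 2 - Num.max y 0 ^+ 2| +
  `|Num.max (- x) 0 ^+ 2 - Num.max (- y) 0 ^+ 2| <= `|x - y| * (`|x| + `|y|).
Proof.
wlog le_yx : x y / y <= x => [H|].
  have [|/ltW lt_xy] := leP y x; first exact: H.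
  have := H y x lt_xy; rewrite (distrC y x) [`|y| + _]addrC.
  by rewrite (distrC (Num.max y 0 ^+ 2)) (distrC (Num.max (- y) 0 ^+ 2)).
have maxp (z : R) : 0 <= z -> Num.max z 0 = z by move/max_idPl.
have maxn (z : R) : z <= 0 -> Num.max z 0 = 0 by move/max_idPr.
rewrite [`|x - y|]ger0_norm ?subr_ge0 //.
have [y_ge0|y_le0] := orP (le_total 0 y).
  have x_ge0 := le_trans y_ge0 le_yx.
  rewrite [Num.max x 0]maxp // [Num.max y 0]maxp // !maxn ?oppr_le0 //.
  rewrite subrr normr0.
  rewrite !ger0_norm //; last by rewrite subr_ge0 lerXn2r ?nnegrE.
  by rewrite !expr2; nra.
have [x_ge0|x_le0] := orP (le_total 0 x).
  rewrite [Num.max x 0]maxp // [Num.max y 0]maxn // [Num.max (- x) 0]maxn ?oppr_le0 //.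
  rewrite maxp ?oppr_ge0 // expr0n /= subr0 sub0r normrN.
  rewrite ![`|_ ^+ 2|]ger0_norm ?sqr_ge0 // ger0_norm // ler0_norm //.
  by rewrite !expr2; nra.
rewrite [Num.max x 0]maxn // [Num.max y 0]maxn // !maxp ?oppr_ge0 // subrr normr0 add0r.
rewrite !sqrrN distrC ger0_norm ?ler0_norm //.
  by rewrite !expr2; nra.
by rewrite subr_ge0 -[x ^+ 2]sqrrN -[y ^+ 2]sqrrN lerXn2r ?nnegrE ?oppr_ge0 ?lerN2.
Qed.

(** Around a median both parts of f - m live on sets of mass at most 1/2, so [coarea] applies to
    their squares. The Cauchy-Schwarz step is a completed square, since the field is only assumed
    ordered and has no square roots. *)
Lemma cheeger w p kappa beta f :
    (forall a b, 0 <= w a b) -> (forall a, w a a = 0) ->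
    (forall a, 0 <= p a) -> \sum_a p a = 1 -> 0 < kappa -> 0 < beta ->
    (forall S, kappa * Num.min (\sum_(a in S) p a) (1 - \sum_(a in S) p a) <=
               graph_energy w (set_indicator S)) ->
    (forall a, graph_energy w (set_indicator [set a]) <= beta * p a) ->
  exists m, kappa ^+ 2 * (\sum_a p a * (f a - m) ^+ 2) <=
            2 * beta * graph_energy w f.
Proof.
move=> w_ge0 w_diag p_ge0 p1 kappa_gt0 beta_gt0 iso deg.
have [m [m_hi m_lo]] := weighted_median f p_ge0 p1.
exists m; pose h a := f a - m.
pose hp a := Num.max (h a) 0; pose hm a := Num.max (- h a) 0.
(* On subsets of the support of g the minimum in [iso] is the mass itself. *)
have half (g : I -> R) : (forall a, 0 <= g a) ->
    \sum_(a | 0 < g a) p a <= 1 / 2 ->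
    kappa * (\sum_a p a * g a ^+ 2) <= \sum_a \sum_b w a b * `|g a ^+ 2 - g b ^+ 2|.
  move=> g_ge0 g_half; apply: coarea => // [a|S]; first exact: sqr_ge0.
  move=> /fintype.subsetP Ssub; apply: le_trans (iso S).
  rewrite ler_pM2l // le_min lexx /=.
  suff : \sum_(a in S) p a <= \sum_(a | 0 < g a) p a by lra.
  rewrite [X in _ <= X](bigID (mem S)) /= [X in X + _](eq_bigl (mem S)).
    by rewrite lerDl sumr_ge0.
  move=> a /=; case: (boolP (a \in S)) => [/Ssub|_]; rewrite ?andbF ?andbT //.
  rewrite inE => g2_gt0; rewrite lt_neqAle g_ge0 andbT eq_sym.
  by apply: contraTneq g2_gt0 => ->; rewrite expr0n ltxx.
have hpP : kappa * (\sum_a p a * hp a ^+ 2) <=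
           \sum_a \sum_b w a b * `|hp a ^+ 2 - hp b ^+ 2|.
  apply: half => [a|]; first by rewrite le_max lexx orbT.
  by under eq_bigl => a do rewrite lt_max ltxx orbF subr_gt0.
have hmP : kappa * (\sum_a p a * hm a ^+ 2) <=
           \sum_a \sum_b w a b * `|hm a ^+ 2 - hm b ^+ 2|.
  apply: half => [a|]; first by rewrite le_max lexx orbT.
  by under eq_bigl => a do rewrite lt_max ltxx orbF oppr_gt0 subr_lt0.
set F := \sum_a _.
have F_split : F = \sum_a p a * hp a ^+ 2 + \sum_a p a * hm a ^+ 2.
  rewrite -big_split; apply: eq_bigr => a _ /=; rewrite -mulrDr; congr (_ * _).
  rewrite -/(h a) /hp /hm; have [ha|ha] := orP (le_total 0 (h a)).
    by rewrite (max_idPl ha) (max_idPr _) ?oppr_le0 //; ring.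
  by rewrite (max_idPr ha) (max_idPl _) ?oppr_ge0 //; ring.
pose xy := \sum_a \sum_b w a b * (`|h a - h b| * (`|h a| + `|h b|)).
have F_xy : kappa * F <= xy.
  rewrite F_split mulrDr; apply: le_trans (lerD hpP hmP) _.
  rewrite -big_split; apply: ler_sum => a _ /=; rewrite -big_split.
  apply: ler_sum => b _ /=; rewrite -mulrDr ler_wpM2l //.
  exact: pos_neg_sqr.
pose yy := \sum_a \sum_b (if a == b then 0 else w a b * (`|h a| + `|h b|) ^+ 2).
(* This uses (u + v)^2 <= 2 u^2 + 2 v^2; the energy of the indicator of a point is the total weight
   of the ordered pairs joining it to other points, that is, the degree bounded by [deg]. *)
have yy_le : yy <= 2 * beta * F.
  apply: (@le_trans _ _
      (\sum_c 2 * h c ^+ 2 * graph_energy w (set_indicator [set c]))); last first.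
    rewrite mulr_sumr; apply: ler_sum => c _; rewrite -/(h c).
    have := ler_wpM2l (mulr_ge0 (ler0n R 2) (sqr_ge0 (h c))) (deg c).
    by move/le_trans; apply; rewrite le_eqVlt; apply/orP; left; apply/eqP; ring.
  under [X in _ <= X]eq_bigr => c _.
    rewrite mulr_sumr; under eq_bigr => a _ do rewrite mulr_sumr.
    over.
  rewrite exchange_big /=; apply: ler_sum => a _.
  rewrite exchange_big /=; apply: ler_sum => b _.
  have [_|ab] := eqVneq a b.
    apply: sumr_ge0 => c _.
    by apply: mulr_ge0; apply: mulr_ge0; rewrite ?sqr_ge0.
  have ba : b != a by rewrite eq_sym.
  rewrite (bigD1 a) //= (bigD1 b) //= big1 => [|c /andP[ca cb]]; last first.
    rewrite /set_indicator !inE ![_ == c]eq_sym (negPf ca) (negPf cb).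
    by rewrite subrr expr0n !mulr0.
  rewrite /set_indicator !inE !eqxx (negPf ab) (negPf ba) addr0 subr0 sub0r.
  rewrite sqrrN expr1n !mulr1 -mulrDl mulrC ler_wpM2r //.
  rewrite -![h _ ^+ 2]real_normK ?num_real //.
  by have := sqr_ge0 (`|h a| - `|h b|); rewrite !expr2; nra.
(* The coefficients 2 beta and kappa are such that, after kappa F <= xy and yy <= 2 beta F, the
   terms in F add up to -2 beta kappa^2 F. *)
have : 0 <= \sum_a \sum_b (if a == b then 0 else
   w a b * (2 * beta * `|h a - h b| - kappa * (`|h a| + `|h b|)) ^+ 2).
  by do 2 (apply: sumr_ge0 => ? _); case: ifP => // _; rewrite mulr_ge0 ?sqr_ge0.
have -> : \sum_a \sum_b (if a == b then 0 else
   w a b * (2 * beta * `|h a - h b| - kappa * (`|h a| + `|h b|)) ^+ 2) =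
   4 * beta ^+ 2 * graph_energy w f - 4 * beta * kappa * xy + kappa ^+ 2 * yy.
  rewrite !mulr_sumr -sumrB -big_split; apply: eq_bigr => a _.
  rewrite !mulr_sumr -sumrB -big_split; apply: eq_bigr => b _ /=.
  case: eqP => [->|_]; first by rewrite w_diag; ring.
  have -> : (f a - f b) ^+ 2 = `|h a - h b| ^+ 2.
    by rewrite real_normK ?num_real // /h; ring.
  ring.
move=> H.
have {}H : 2 * beta * (kappa ^+ 2 * F) <= 2 * beta * (2 * beta * graph_energy w f).
  have k2yy := ler_wpM2l (sqr_ge0 kappa) yy_le.
  have := ler_wpM2l (ltW (mulr_gt0 beta_gt0 kappa_gt0)) F_xy.
  by move: H k2yy; rewrite !expr2; nra.
by move: H; rewrite ler_pM2l // mulr_gt0.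
Qed.

(** Only the terms a and b of the variance around m are kept, each of mass at least delta; (u - v)^2
    <= 2 u^2 + 2 v^2 costs the further factor 2. *)
Lemma cheeger_spread w p kappa beta delta f :
    (forall a b, 0 <= w a b) -> (forall a, w a a = 0) ->
    0 <= delta -> (forall a, delta <= p a) -> \sum_a p a = 1 ->
    0 < kappa -> 0 < beta ->
    (forall S, kappa * Num.min (\sum_(a in S) p a) (1 - \sum_(a in S) p a) <=
               graph_energy w (set_indicator S)) ->
    (forall a, graph_energy w (set_indicator [set a]) <= beta * p a) ->
  forall a b, kappa ^+ 2 * delta * (f a - f b) ^+ 2 <= 4 * beta * graph_energy w f.
Proof.
move=> w_ge0 w_diag delta_ge0 p_ge p1 kappa_gt0 beta_gt0 iso deg a b.
have p_ge0 c : 0 <= p c := le_trans delta_ge0 (p_ge c).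
have [m Hm] := cheeger f w_ge0 w_diag p_ge0 p1 kappa_gt0 beta_gt0 iso deg.
have [->|ab] := eqVneq a b.
  rewrite subrr expr0n mulr0 !mulr_ge0 ?(ltW beta_gt0) //.
  by do 2 (apply: sumr_ge0 => ? _); rewrite mulr_ge0 ?sqr_ge0.
suff H : delta * (f a - f b) ^+ 2 <= 2 * \sum_a p a * (f a - m) ^+ 2.
  rewrite -mulrA; apply: le_trans (ler_wpM2l (sqr_ge0 kappa) H) _.
  by rewrite mulrCA; move: Hm; lra.
rewrite (bigD1 a) //= (bigD1 b) 1?eq_sym //= addrA mulrDr.
have rest : 0 <= \sum_(i | (i != a) && (i != b)) p i * (f i - m) ^+ 2.
  by apply: sumr_ge0 => c _; rewrite mulr_ge0 ?sqr_ge0.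
have Ha := ler_wpM2r (sqr_ge0 (f a - m)) (p_ge a).
have Hb := ler_wpM2r (sqr_ge0 (f b - m)) (p_ge b).
have : delta * (f a - f b) ^+ 2 <= 2 * (delta * (f a - m) ^+ 2 + delta * (f b - m) ^+ 2).
  rewrite -subr_ge0; apply: le_trans (mulr_ge0 delta_ge0 (sqr_ge0 (f a + f b - 2 * m))) _.
  by rewrite le_eqVlt; apply/orP; left; apply/eqP; ring.
by move: rest Ha Hb; lra.
Qed.
End WeightedGraph.

Local Open Scope complex_scope.

(** * Operator norms *)

Section Modulus.
Context {R : realType}.
Implicit Types x y z : R[i].

(** The norm of [R[i]] takes its values in [R[i]]; this is the modulus as an element of R. *)
Definition cabs z : R := complex.Re `|z|.

Lemma cabsE z : `|z| = (cabs z)%:C.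
Proof. by rewrite /cabs RRe_real ?normr_real. Qed.

Lemma cabs_ge0 z : 0 <= cabs z.
Proof. by rewrite -ler0c -cabsE. Qed.

Lemma cabs0 : cabs 0 = 0.
Proof. by rewrite /cabs normr0. Qed.

Lemma cabs0_eq0 z : cabs z = 0 -> z = 0.
Proof. by move=> z0; apply/eqP; rewrite -normr_eq0 cabsE z0. Qed.

Lemma cabsM x y : cabs (x * y) = cabs x * cabs y.
Proof. by apply: complexI; rewrite -cabsE normrM !cabsE -rmorphM. Qed.

Lemma cabsD x y : cabs (x + y) <= cabs x + cabs y.
Proof. by rewrite -lecR rmorphD /= -!cabsE ler_normD. Qed.

Lemma cabsN x : cabs (- x) = cabs x.
Proof. by rewrite /cabs normrN. Qed.

Lemma cabs_real (r : R) : cabs r%:C = `|r|.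
Proof.
have [r0|r0] := leP 0 r; rewrite /cabs.
  by rewrite ger0_norm ?ler0c // ger0_norm.
by rewrite ltr0_norm ?ltcR // ltr0_norm.
Qed.

Lemma cabs_sum (I : finType) (F : I -> R[i]) :
  cabs (\sum_i F i) <= \sum_i cabs (F i).
Proof.
by rewrite -lecR rmorph_sum -cabsE (le_trans (ler_norm_sum _ _ _)) //;
   apply: ler_sum => i _; rewrite cabsE.
Qed.

Lemma Re_le_cabs z : `|complex.Re z| <= cabs z.
Proof. by rewrite -lecR -cabsE normc_ge_Re. Qed.

End Modulus.

Section OperatorNorm.
Context {R : realType}.

Lemma opnorm_le (U : zmodType) (N : U -> R) (f : U -> U) B : 0 <= B ->
  (forall x, x != 0 -> 0 < N x) -> (forall x, N (f x) <= B * N x) ->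
  opnorm N f <= B.
Proof.
move=> B_ge0 N_gt0 bnd; rewrite /opnorm.
have [|no] := pselect ([set N (f x) / N x | x in [set x : U | x != 0]] !=set0)%classic.
  by move/ge_sup; apply=> _ [x /= x0 <-]; rewrite ler_pdivrMr ?N_gt0.
(* No nonzero vector means an empty set of ratios, whose [sup] is 0 by default. *)
by rewrite sup_out // => -[].
Qed.

(* Without the bound B the supremum could take its junk value 0. *)
Lemma le_opnorm (U : zmodType) (N : U -> R) (f : U -> U) B x :
  (forall x, x != 0 -> 0 < N x) -> N (f 0) = 0 ->  N 0 = 0 ->
  (forall x, N (f x) <= B * N x) ->
  N (f x) <= opnorm N f * N x.
Proof.
move=> N_gt0 f0 N0 bnd; have [->|x0] := eqVneq x 0; first by rewrite f0 N0 mulr0.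
rewrite -ler_pdivrMr ?N_gt0 //; apply: ub_le_sup; last by exists x.
by exists B => _ [y /= y0 <-]; rewrite ler_pdivrMr ?N_gt0.
Qed.

Lemma opnorm_ge0 (U : zmodType) (N : U -> R) (f : U -> U) :
  (forall x, 0 <= N x) -> 0 <= opnorm N f.
Proof.
move=> N_ge0; rewrite /opnorm; set A := (X in sup X).
have [sA|no] := pselect (has_sup A); last by rewrite sup_out.
have [[y Ay] ubA] := sA; apply: le_trans (ub_le_sup ubA Ay).
by case: Ay => x _ <-; rewrite divr_ge0.
Qed.

(** Auxiliary norm through which all boundedness and comparison facts become finite sums; its
    dimensional constants never reach the theorem. *)
Definition l1_norm m p (A : 'M[R[i]]_(m, p)) : R := \sum_i \sum_j cabs (A i j).

Lemma l1_norm_ge0 m p (A : 'M[R[i]]_(m, p)) : 0 <= l1_norm A.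
Proof. by do 2 (apply: sumr_ge0 => ? _); exact: cabs_ge0. Qed.

Lemma cabs_le_l1 m p (A : 'M[R[i]]_(m, p)) i j : cabs (A i j) <= l1_norm A.
Proof.
rewrite /l1_norm (bigD1 i) //= (bigD1 j) //= -addrA lerDl addr_ge0 //.
  by apply: sumr_ge0 => ? _; exact: cabs_ge0.
by do 2 (apply: sumr_ge0 => ? _); exact: cabs_ge0.
Qed.

Lemma l1_normD m p (A B : 'M[R[i]]_(m, p)) : l1_norm (A + B) <= l1_norm A + l1_norm B.
Proof.
rewrite -big_split; apply: ler_sum => i _; rewrite -big_split.
by apply: ler_sum => j _; rewrite mxE cabsD.
Qed.

Lemma l1_normZ m p c (A : 'M[R[i]]_(m, p)) : l1_norm (c *: A) = cabs c * l1_norm A.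
Proof.
rewrite /l1_norm mulr_sumr; apply: eq_bigr => i _.
by rewrite mulr_sumr; apply: eq_bigr => j _; rewrite mxE cabsM.
Qed.

Lemma l1_norm0 m p : l1_norm (0 : 'M[R[i]]_(m, p)) = 0.
Proof. by rewrite -(scale0r 0) l1_normZ cabs0 mul0r. Qed.

Lemma l1_norm_sum m p (I : finType) (F : I -> 'M[R[i]]_(m, p)) :
  l1_norm (\sum_i F i) <= \sum_i l1_norm (F i).
Proof.
elim/big_rec2: _ => [|i x y _ H]; first by rewrite l1_norm0.
by apply: le_trans (l1_normD _ _) _; rewrite lerD2l.
Qed.

Lemma linear_l1_bounded m p q r (f : {linear 'M[R[i]]_(m, p) -> 'M[R[i]]_(q, r)}) :
  exists2 B, 0 <= B & forall X, l1_norm (f X) <= B * l1_norm X.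
Proof.
exists (\sum_i \sum_j l1_norm (f (delta_mx i j))).
  by do 2 (apply: sumr_ge0 => ? _); exact: l1_norm_ge0.
move=> X; rewrite {1}[X]matrix_sum_delta linear_sum.
apply: le_trans (l1_norm_sum _) _; rewrite mulr_suml; apply: ler_sum => i _.
rewrite linear_sum; apply: le_trans (l1_norm_sum _) _.
rewrite mulr_suml; apply: ler_sum => j _.
by rewrite linearZ l1_normZ mulrC ler_wpM2l ?l1_norm_ge0 // cabs_le_l1.
Qed.

Lemma euclidean_normE m (v : 'cV[R[i]]_m) :
  euclidean_norm v = Num.sqrt (\sum_i cabs (v i 0) ^+ 2).
Proof.
rewrite /euclidean_norm mulmx_adj_self; congr (Num.sqrt _).
under eq_bigr => i _ do rewrite cabsE -rmorphXn /=.
by rewrite -rmorph_sum.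
Qed.

Lemma cabs_le_euclidean m (v : 'cV[R[i]]_m) i : cabs (v i 0) <= euclidean_norm v.
Proof.
rewrite euclidean_normE -[X in X <= _]ger0_norm ?cabs_ge0 // -sqrtr_sqr ler_wsqrtr //.
by rewrite (bigD1 i) //= lerDl sumr_ge0 // => j _; rewrite sqr_ge0.
Qed.

Lemma euclidean_le_l1 m (v : 'cV[R[i]]_m) : euclidean_norm v <= l1_norm v.
Proof.
rewrite euclidean_normE -[X in _ <= X]ger0_norm ?l1_norm_ge0 // -sqrtr_sqr ler_wsqrtr //.
apply: (@le_trans _ _ (\sum_i cabs (v i 0) * l1_norm v)).
  by apply: ler_sum => i _; rewrite expr2 ler_wpM2l ?cabs_ge0 ?cabs_le_l1.
rewrite -mulr_suml expr2 ler_wpM2r ?l1_norm_ge0 //.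
by apply: ler_sum => i _; rewrite big_ord1.
Qed.

Lemma euclidean_gt0 m (v : 'cV[R[i]]_m) : v != 0 -> 0 < euclidean_norm v.
Proof.
case/cV0Pn => i vi; apply: lt_le_trans (cabs_le_euclidean v i).
by rewrite lt_neqAle cabs_ge0 andbT eq_sym; apply: contra vi => /eqP/cabs0_eq0 ->.
Qed.

Lemma euclidean0 m : euclidean_norm (0 : 'cV[R[i]]_m) = 0.
Proof.
apply/eqP; rewrite eq_le sqrtr_ge0 andbT.
by apply: le_trans (euclidean_le_l1 _) _; rewrite l1_norm0.
Qed.

Lemma euclidean_mul_le m (A : 'M[R[i]]_m) v :
  euclidean_norm (A *m v) <= l1_norm A * euclidean_norm v.
Proof.
apply: le_trans (euclidean_le_l1 _) _.
rewrite /l1_norm mulr_suml; apply: ler_sum => i _; rewrite big_ord1 mxE.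
apply: le_trans (cabs_sum _) _; rewrite mulr_suml; apply: ler_sum => j _.
by rewrite cabsM ler_wpM2l ?cabs_ge0 ?cabs_le_euclidean.
Qed.

Lemma cstar_ge0 m (A : 'M[R[i]]_m) : 0 <= cstar_norm A.
Proof. by apply: opnorm_ge0 => v; exact: sqrtr_ge0. Qed.

Lemma cstar_le_l1 m (A : 'M[R[i]]_m) : cstar_norm A <= l1_norm A.
Proof.
apply: opnorm_le => [|v|v]; first exact: l1_norm_ge0.
  exact: euclidean_gt0.
exact: euclidean_mul_le.
Qed.

Lemma cabs_le_cstar m (A : 'M[R[i]]_m) i j : cabs (A i j) <= cstar_norm A.
Proof.
have := @le_opnorm _ (@euclidean_norm R m) (mulmx A) (l1_norm A) (delta_mx j 0)
  (@euclidean_gt0 m) _ (euclidean0 m) (euclidean_mul_le A).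
rewrite mulmx0 euclidean0 => /(_ erefl).
have -> : euclidean_norm (delta_mx j 0 : 'cV[R[i]]_m) = 1.
  rewrite euclidean_normE (bigD1 j) //= big1 => [|k kj].
    by rewrite mxE !eqxx /= cabs_real normr1 expr1n addr0 sqrtr1.
  by rewrite mxE (negPf kj) cabs0 expr0n.
rewrite mulr1; apply: le_trans; rewrite -colE.
by have := cabs_le_euclidean (col j A) i; rewrite mxE.
Qed.

Lemma l1_le_cstar m (A : 'M[R[i]]_m) : l1_norm A <= m%:R ^+ 2 * cstar_norm A.
Proof.
apply: (@le_trans _ _ (\sum_(i < m) \sum_(j < m) cstar_norm A)).
  by do 2 (apply: ler_sum => ? _); exact: cabs_le_cstar.
by rewrite !sumr_const !card_ord -[_ *+ m *+ m]mulr_natl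
  -[cstar_norm A *+ m]mulr_natl mulrA expr2.
Qed.

Lemma cstar_gt0 m (A : 'M[R[i]]_m) : A != 0 -> 0 < cstar_norm A.
Proof.
case/matrix0Pn => i [j Aij]; apply: lt_le_trans (cabs_le_cstar A i j).
by rewrite lt_neqAle cabs_ge0 andbT eq_sym; apply: contra Aij => /eqP/cabs0_eq0 ->.
Qed.

Lemma cstar0 m : cstar_norm (0 : 'M[R[i]]_m) = 0.
Proof.
apply/eqP; rewrite eq_le; apply/andP; split.
  by apply: le_trans (cstar_le_l1 _) _; rewrite l1_norm0.
exact: cstar_ge0.
Qed.

(** Linearity supplies the a priori bound that makes the operator norm a genuine supremum. *)
Lemma l1_le_opnorm m (f : {linear 'M[R[i]]_m -> 'M[R[i]]_m}) X :
  l1_norm (f X) <= m%:R ^+ 2 * (opnorm (@cstar_norm R m) f * l1_norm X).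
Proof.
apply: le_trans (l1_le_cstar _) _; rewrite ler_wpM2l ?sqr_ge0 //.
have [B B_ge0 bnd] := linear_l1_bounded f.
apply: le_trans (@le_opnorm _ _ _ (B * m%:R ^+ 2) X (@cstar_gt0 m) _ (cstar0 m) _) _.
- by rewrite linear0 cstar0.
- move=> Y; apply: le_trans (cstar_le_l1 _) _; apply: le_trans (bnd Y) _.
  by rewrite -mulrA ler_wpM2l // l1_le_cstar.
rewrite ler_wpM2l ?cstar_le_l1 //.
exact/opnorm_ge0/cstar_ge0.
Qed.

End OperatorNorm.

(** * The generator as a derivative *)

Section Generator.
Context {R : realType} {n : nat}.
Local Notation M := 'M[R[i]]_n.

Lemma l1_iter_bound (L : {linear M -> M}) :
  exists2 b, 0 <= b & forall k X, l1_norm (iter k L X) <= b ^+ k * l1_norm X.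
Proof.
have [b b_ge0 bnd] := linear_l1_bounded L; exists b => // k X.
elim: k => [|k IHk]; first by rewrite expr0 mul1r.
by rewrite iterS exprS -mulrA (le_trans (bnd _)) // ler_wpM2l.
Qed.

Lemma exp_partial_sum_le (b : R) m : 0 <= b ->
  \sum_(k < m) b ^+ k / k`!%:R <= limn (series (exp_coeff b)).
Proof.
move=> b_ge0; rewrite -(big_mkord xpredT (fun k => b ^+ k / k`!%:R)).
have nd : {homo series (exp_coeff b) : p q / (p <= q)%N >-> p <= q}.
  by apply/nondecreasing_series => k _ _; exact: exp_coeff_ge0.
exact: (nondecreasing_cvgn_le nd (is_cvg_series_exp_coeff b)).
Qed.

(** First-order expansion with an explicit quadratic remainder. It replaces differentiation of the
    semigroup: all later passages to t = 0 are elementary inequalities in t. *)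
Lemma generator_taylor (Phi : R -> {linear M -> M}) (L : {linear M -> M}) X :
    is_generator Phi L ->
  exists2 K, 0 <= K & forall t, 0 < t -> t <= 1 ->
    l1_norm (X - t%:C *: L X - Phi t X) <= K * t ^+ 2.
Proof.
move=> gen; have [b b_ge0 bnd] := l1_iter_bound L.
set e := limn (series (exp_coeff b)).
have e_ge0 : 0 <= e by have := exp_partial_sum_le 0 b_ge0; rewrite big_ord0.
exists (e * l1_norm X) => [|t t_gt0 t_le1]; first by rewrite mulr_ge0 ?l1_norm_ge0.
pose c k : R[i] := ((- t) ^+ k / k`!%:R)%:C.
pose S m := \sum_(k < m) c k *: iter k L X.
have c0 : c 0%N = 1 by rewrite /c expr0 fact0 divr1.
have c1 : c 1%N = - t%:C by rewrite /c expr1 divr1 rmorphN.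
have tail m : l1_norm (X - t%:C *: L X - S m.+2) <= e * l1_norm X * t ^+ 2.
  have -> : X - t%:C *: L X - S m.+2 =
            - \sum_(k < m) c k.+2 *: iter k.+2 L X.
    rewrite /S 2!big_ord_recl /= c0 c1 scale1r scaleNr addrA opprD addrA subrr add0r.
    by [].
  rewrite -scaleN1r l1_normZ cabsN (_ : cabs 1 = 1) ?mul1r; last first.
    by rewrite -[1]/(1%:C) cabs_real normr1.
  apply: le_trans (l1_norm_sum _) _.
  (* For t <= 1 the k-th tail term carries t^(k+2) <= t^2, and what remains is part of the
     exponential series of b. *)
  apply: (@le_trans _ _
     ((\sum_(k < m.+2) b ^+ k / k`!%:R) * (l1_norm X * t ^+ 2))); last first.
    rewrite -mulrA; apply: ler_wpM2r; last exact: exp_partial_sum_le.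
    by rewrite mulr_ge0 ?l1_norm_ge0 ?sqr_ge0.
  rewrite 2!big_ord_recl /= addrA mulrDl ler_wpDl //.
    apply: mulr_ge0; last by rewrite mulr_ge0 ?l1_norm_ge0 ?sqr_ge0.
    by apply: addr_ge0; apply: mulr_ge0; rewrite ?exprn_ge0 ?invr_ge0 ?ler0n.
  rewrite mulr_suml; apply: ler_sum => k _; rewrite l1_normZ.
  rewrite cabs_real normrM normrX normrN (gtr0_norm t_gt0) ger0_norm ?invr_ge0 ?ler0n //.
  apply: le_trans (ler_wpM2l _ (bnd k.+2 X)) _.
    by rewrite mulr_ge0 ?exprn_ge0 ?invr_ge0 ?ler0n // ltW.
  have -> : t ^+ k.+2 / k.+2`!%:R * (b ^+ k.+2 * l1_norm X) =
     t ^+ k * (b ^+ k.+2 / k.+2`!%:R * (l1_norm X * t ^+ 2)).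
    by rewrite -addn2 exprD; ring.
  rewrite ler_piMl // ?exprn_ile1 ?(ltW t_gt0) //.
  by apply: mulr_ge0; apply: mulr_ge0;
    rewrite ?l1_norm_ge0 ?sqr_ge0 ?exprn_ge0 ?invr_ge0 ?ler0n.
(* The tail bound is uniform in the number of terms, so a partial sum may be chosen within eps of
   [Phi t X]; the + 1 in [delta] covers X = 0. *)
apply/ler_addgt0Pr => eps eps_gt0.
have n2_ge0 : 0 <= n%:R ^+ 2 * l1_norm X by rewrite mulr_ge0 ?sqr_ge0 ?l1_norm_ge0.
pose delta := eps / (n%:R ^+ 2 * l1_norm X + 1).
have delta_gt0 : 0 < delta by rewrite divr_gt0 // ltr_wpDl.
have [N _ HN] := cvgr0_norm_lt _ (gen t (ltW t_gt0)) _ delta_gt0.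
pose f m (Y : M) := Phi t Y - \sum_(k < m) c k *: iter k L Y.
have f_lin m : linear (f m).
  move=> a Y Z; rewrite /f linearP.
  have iterP k : iter k L (a *: Y + Z) = a *: iter k L Y + iter k L Z.
    by elim: k => //= k ->; rewrite linearP.
  under eq_bigr => k _ do rewrite iterP scalerDr scalerA mulrC -scalerA.
  by rewrite big_split /= -scaler_sumr scalerBr opprD addrACA.
have -> : X - t%:C *: L X - Phi t X = (X - t%:C *: L X - S N.+2) - f N.+2 X.
  by rewrite /f /S opprB addrA subrK.
apply: le_trans (l1_normD _ _) _; rewrite lerD ?tail //.
rewrite -scaleN1r l1_normZ cabsN (_ : cabs 1 = 1) ?mul1r; last first.
  by rewrite -[1]/(1%:C) cabs_real normr1.
pose g : {linear M -> M} := HB.pack (f N.+2) (GRing.isLinear.Build _ _ _ _ _ (f_lin N.+2)).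
apply: le_trans (l1_le_opnorm g X) _.
have /(_ _)/ltW := HN N.+2 _; rewrite /= => /(_ (leq_trans (leqnSn _) (leqnSn _))).
move=> /(le_trans (ler_norm _)) op_le.
rewrite mulrCA; apply: le_trans (ler_wpM2r n2_ge0 op_le) _.
rewrite /delta mulrAC ler_pdivrMr ?ltr_wpDl //.
by rewrite ler_wpM2l ?(ltW eps_gt0) // lerDl.
Qed.

End Generator.

(** * The KMS inner product *)

Section KMS.
Context {R : realType} {n : nat}.
Local Notation M := 'M[R[i]]_n.

Lemma kmsE (D X Y : M) : kms D X Y = wform (sqrtmx D) X Y.
Proof. by []. Qed.

Lemma psd_mxblockP k (A : 'I_k -> 'I_k -> M) :
  psdmx (\mxblock_(i, j) A i j) <-> psd_blocks A.
Proof.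
have adj_block : (\mxblock_(i, j) A i j)^t* = \mxblock_(i, j) (A j i)^t*.
  by rewrite tr_mxblock; apply/matrixP => i j; rewrite !mxE.
have quad (v : 'I_k -> 'cV[R[i]]_n) :
    ((\mxcol_i v i)^t* *m \mxblock_(i, j) A i j *m \mxcol_i v i) 0 0 =
    \sum_p \sum_q ((v p)^t* *m A p q *m v q) 0 0.
  have -> : (\mxcol_i v i)^t* = \mxrow_i (v i)^t*.
    by rewrite tr_mxcol; apply/matrixP => i j; rewrite !mxE.
  rewrite mul_mxrow_mxblock mul_mxrow_mxcol summxE exchange_big.
  by apply: eq_bigr => q _; rewrite mulmx_suml summxE.
split=> [[/hermP H psd]|[H psd]]; split.
- move: H; rewrite adj_block => /eq_mxblockP H p q; by rewrite H.
- by move=> v; rewrite -quad.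
- by apply/hermP; rewrite adj_block; apply: eq_mxblock => p q; rewrite -H.
- by move=> v; rewrite -[v]submxcolK quad.
Qed.

Lemma re_conj (z : R[i]) : complex.Re (z^*)%R = complex.Re z.
Proof. by apply: complexI; rewrite !complexRe Re_conj. Qed.

Lemma re_scale (r : R) (z : R[i]) : complex.Re (r%:C * z) = r * complex.Re z.
Proof. by case: z => a b /=; rewrite mul0r subr0. Qed.

Lemma re_le (x y : R[i]) : x <= y -> complex.Re x <= complex.Re y.
Proof. by rewrite lecE => /andP[]. Qed.

Variable D : M.
Hypothesis D_posdef : posdefmx D.

Lemma state_adj : D^t* = D.
Proof. by case: D_posdef => /hermP. Qed.

Lemma state_pos (v : 'cV[R[i]]_n) : v != 0 -> 0 < (v^t* *m D *m v) 0 0.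
Proof. by case: D_posdef => _; exact. Qed.

Let r k : R := complex.Re (spectral_diag D 0 k).

Local Lemma rE k : spectral_diag D 0 k = (r k)%:C.
Proof. by rewrite RRe_real // spectral_diag_real // state_adj. Qed.

Local Lemma r_gt0 k : 0 < r k.
Proof. by rewrite -ltcR -rE; exact: (spectral_diag_gt0 state_adj state_pos). Qed.

Local Lemma eigenvalue_r x : eigenvalue D x%:C <-> exists k, x = r k.
Proof.
split=> [/(eigenvalue_spectral_diag state_adj)[k]|[k ->]].
  by rewrite rE => /complexI ->; exists k.
by apply/(eigenvalue_spectral_diag state_adj); exists k; rewrite rE.
Qed.

Lemma min_eigenvalue_le k : (min_eigenvalue D)%:C <= spectral_diag D 0 k.
Proof.
rewrite rE lecR; apply: ge_inf; last by apply/eigenvalue_r; exists k.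
by exists 0 => x /eigenvalue_r[j ->]; exact/ltW/r_gt0.
Qed.

Lemma max_eigenvalue_ge k : spectral_diag D 0 k <= (max_eigenvalue D)%:C.
Proof.
rewrite rE lecR; apply: ub_le_sup; last by apply/eigenvalue_r; exists k.
exists (\sum_j r j) => x /eigenvalue_r[j ->].
by rewrite (bigD1 j) //= lerDl sumr_ge0 // => i _; exact/ltW/r_gt0.
Qed.

Lemma min_eigenvalue_gt0 : (0 < n)%N -> 0 < min_eigenvalue D.
Proof.
move=> n_gt0; have [k _ k_min] := arg_minP r (erefl (xpredT (Ordinal n_gt0))).
apply: lt_le_trans (r_gt0 k) _; apply: lb_le_inf.
  by exists (r k); apply/eigenvalue_r; exists k.
by move=> x /eigenvalue_r[j ->]; apply: k_min.
Qed.

Lemma sqrtmx_diagE :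
  sqrtmx D = (spectralmx D)^t* *m diag_mx (sqrt_diag D) *m spectralmx D.
Proof. by rewrite /sqrtmx invmx_unitary ?spectral_unitarymx. Qed.

Lemma sqrtmx_sqr : sqrtmx D *m sqrtmx D = D.
Proof. exact: (sqrt_diag_sqr state_adj sqrtmx_diagE). Qed.

Lemma sqrtmx_adj : (sqrtmx D)^t* = sqrtmx D.
Proof.
rewrite sqrtmx_diagE adj_mul_diag // => k.
by apply/gtr0_real/(sqrt_diag_gt0 state_adj state_pos).
Qed.

Lemma sqrt_diag_bounds k l : (0 < n)%N ->
  (min_eigenvalue D)%:C <= sqrt_diag D 0 k * sqrt_diag D 0 l <= (max_eigenvalue D)%:C.
Proof.
move=> n_gt0; apply: (sqrt_diag_mul_bounds state_adj state_pos) => [|j].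
  by rewrite ler0c ltW // min_eigenvalue_gt0.
by rewrite min_eigenvalue_le max_eigenvalue_ge.
Qed.

End KMS.

(** Stands for division by t and passage to the limit t = 0. *)
Lemma ge0_of_quadratic_error (R : realFieldType) (a K : R) : 0 <= K ->
  (forall t, 0 < t -> t <= 1 -> - (K * t ^+ 2) <= t * a) -> 0 <= a.
Proof.
move=> K_ge0 H; rewrite leNgt; apply/negP => a_lt0.
(* Chosen so that t <= 1 and K t < - a, which contradicts the hypothesis divided by t. *)
pose t := - a / (K + 1 - a).
have den_gt0 : 0 < K + 1 - a by lra.
have t_gt0 : 0 < t by rewrite divr_gt0 ?oppr_gt0.
have t_le1 : t <= 1 by rewrite ler_pdivrMr //; lra.
have := H t t_gt0 t_le1; rewrite expr2 mulrCA -mulrN ler_pM2l // => Kt.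
have : t * (K + 1 - a) = - a by rewrite divfK // gt_eqF.
nra.
Qed.

(** * Real quadratic forms, the Hilbert-Schmidt norm and the KMS norm *)

Section RealForms.
Context {R : realType} {n : nat}.
Local Notation M := 'M[R[i]]_n.

(** The form is only semidefinite: this covers the Dirichlet form, which vanishes on scalars, as
    well as the KMS product. *)
Lemma form_cauchy_schwarz (b : M -> M -> R) :
    (forall X Y Z, b X (Y + Z) = b X Y + b X Z) ->
    (forall t X Y, b X (t%:C *: Y) = t * b X Y) ->
    (forall X Y, b X Y = b Y X) -> (forall X, 0 <= b X X) ->
  forall X Y, b X Y ^+ 2 <= b X X * b Y Y.
Proof.
move=> bD bZ bC b_ge0 X Y.
have key s t : 0 <= s ^+ 2 * b X X + 2 * s * t * b X Y + t ^+ 2 * b Y Y.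
  have := b_ge0 (s%:C *: X + t%:C *: Y).
  rewrite bD !bZ ![b (_ + _) _]bC !bD !bZ (bC Y X); congr (0 <= _); ring.
have := key (b Y Y) (- b X Y); have [Y0|Y0] := eqVneq (b Y Y) 0; last first.
  have Yp : 0 < b Y Y by rewrite lt_neqAle eq_sym Y0 b_ge0.
  move=> H; rewrite -(ler_pM2l Yp) -subr_ge0; move: H; congr (0 <= _); ring.
move=> _; rewrite Y0 mulr0; have [->|u0] := eqVneq (b X Y) 0; first by rewrite expr0n.
(* With b Y Y = 0 the quadratic is affine in t; this t gives it the impossible value -1. *)
have := key 1 (- (b X X + 1) / (2 * b X Y)); rewrite Y0.
have -> : 1 ^+ 2 * b X X + 2 * 1 * (- (b X X + 1) / (2 * b X Y)) * b X Y +
    (- (b X X + 1) / (2 * b X Y)) ^+ 2 * 0 = -1 by field.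
lra.
Qed.

Lemma mxtrace_mul_l1 (A B : M) : cabs (\tr (A *m B)) <= l1_norm A * l1_norm B.
Proof.
rewrite /mxtrace; apply: le_trans (cabs_sum _) _.
rewrite {1}/l1_norm mulr_suml; apply: ler_sum => i _; rewrite mxE mulr_suml.
apply: le_trans (cabs_sum _) _; apply: ler_sum => j _.
by rewrite cabsM ler_wpM2l ?cabs_ge0 ?cabs_le_l1.
Qed.

Definition hsr (X : M) : R := \sum_i \sum_j cabs (X i j) ^+ 2.

Lemma hs_norm2_re X : hs_norm2 X = (hsr X)%:C.
Proof.
rewrite /hsr rmorph_sum; apply: eq_bigr => i _; rewrite rmorph_sum.
by apply: eq_bigr => j _; rewrite cabsE rmorphXn.
Qed.

Lemma hsr_ge0 X : 0 <= hsr X.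
Proof. by do 2 (apply: sumr_ge0 => ? _); exact: sqr_ge0. Qed.

Lemma hsr_le_l1 X : hsr X <= l1_norm X ^+ 2.
Proof.
rewrite {1}/hsr expr2 {1}/l1_norm mulr_suml; apply: ler_sum => i _.
rewrite mulr_suml; apply: ler_sum => j _.
by rewrite expr2 ler_wpM2l ?cabs_ge0 ?cabs_le_l1.
Qed.

Lemma l1_le_hsr X : l1_norm X <= n%:R ^+ 2 * Num.sqrt (hsr X).
Proof.
apply: (@le_trans _ _ (\sum_(i < n) \sum_(j < n) Num.sqrt (hsr X))).
  apply: ler_sum => i _; apply: ler_sum => j _.
  rewrite -[X in X <= _]ger0_norm ?cabs_ge0 // -sqrtr_sqr ler_wsqrtr //.
  rewrite /hsr (bigD1 i) //= (bigD1 j) //= -addrA lerDl addr_ge0 //.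
    by apply: sumr_ge0 => ? _; exact: sqr_ge0.
  by do 2 (apply: sumr_ge0 => ? _); exact: sqr_ge0.
by rewrite !sumr_const !card_ord -[_ *+ n *+ n]mulr_natl
  -[Num.sqrt _ *+ n]mulr_natl mulrA expr2.
Qed.

Lemma linear_hsr_bounded (f : {linear M -> M}) :
  exists2 B, 0 <= B & forall X, hsr (f X) <= B * hsr X.
Proof.
have [B B_ge0 bnd] := linear_l1_bounded f.
exists ((B * n%:R ^+ 2) ^+ 2) => [|X]; first exact: sqr_ge0.
apply: le_trans (hsr_le_l1 _) _.
have -> : (B * n%:R ^+ 2) ^+ 2 * hsr X = (B * (n%:R ^+ 2 * Num.sqrt (hsr X))) ^+ 2.
  by rewrite [RHS]exprMn [in RHS]exprMn sqr_sqrtr ?hsr_ge0 //; ring.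
rewrite lerXn2r ?nnegrE ?l1_norm_ge0 ?mulr_ge0 ?sqr_ge0 ?sqrtr_ge0 //.
by apply: le_trans (bnd X) _; rewrite ler_wpM2l // l1_le_hsr.
Qed.

Lemma hsr_gt0 X : X != 0 -> 0 < hsr X.
Proof.
move=> X0; rewrite lt_neqAle hsr_ge0 andbT eq_sym; apply: contra X0 => /eqP X0.
apply/eqP/matrixP => i j; rewrite mxE; apply: cabs0_eq0.
have := l1_le_hsr X; rewrite X0 sqrtr0 mulr0 => l1X.
by apply/eqP; rewrite eq_le cabs_ge0 andbT (le_trans (cabs_le_l1 X i j)).
Qed.

Section InnerProduct.
Variable D : M.
Hypothesis D_posdef : posdefmx D.
Hypothesis n_gt0 : (0 < n)%N.
Local Notation sm := (min_eigenvalue D).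
Local Notation sp := (max_eigenvalue D).

Definition ip (X Y : M) : R := complex.Re (kms D X Y).

Lemma kmsD X Y Z : kms D X (Y + Z) = kms D X Y + kms D X Z.
Proof. by rewrite /kms mulmxDr mulmxDl mxtraceD. Qed.

Lemma kmsZ t X Y : kms D X (t *: Y) = t * kms D X Y.
Proof. by rewrite /kms -scalemxAr -scalemxAl mxtraceZ. Qed.

Lemma ipD X Y Z : ip X (Y + Z) = ip X Y + ip X Z.
Proof. by rewrite /ip kmsD; case: (kms D X Y) (kms D X Z) => [? ?] [? ?]. Qed.

Lemma ipZ t X Y : ip X (t%:C *: Y) = t * ip X Y.
Proof. by rewrite /ip kmsZ re_scale. Qed.

Lemma ipN X Y : ip X (- Y) = - ip X Y.
Proof. by rewrite -scaleN1r -[-1](rmorphN1 (real_complex R)) ipZ mulN1r. Qed.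

Lemma ipB X Y Z : ip X (Y - Z) = ip X Y - ip X Z.
Proof. by rewrite ipD ipN. Qed.

Lemma ipC X Y : ip X Y = ip Y X.
Proof. by rewrite /ip !kmsE (wform_conj _ _ (sqrtmx_adj D_posdef)) re_conj. Qed.

Lemma ip_l1 Y : exists2 A, 0 <= A & forall Z, `|ip Y Z| <= A * l1_norm Z.
Proof.
exists (l1_norm (sqrtmx D *m (Y^t* *m sqrtmx D))); first exact: l1_norm_ge0.
move=> Z; apply: le_trans (Re_le_cabs _) _.
rewrite /kms; move: (sqrtmx D) (Y^t*) => S T.
by apply: le_trans (mxtrace_mul_l1 _ _); rewrite mxtrace_mulC !mulmxA.
Qed.

Lemma ip_ge_hsr X : sm * hsr X <= ip X X.
Proof.
have := hs_le_wform (spectral_unitarymx D) (sqrtmx_diagE D) X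
  (fun k l => proj1 (andP (sqrt_diag_bounds D_posdef k l n_gt0))).
by rewrite hs_norm2_re -rmorphM => /re_le.
Qed.

Lemma ip_le_hsr X : ip X X <= sp * hsr X.
Proof.
have := wform_le_hs (spectral_unitarymx D) (sqrtmx_diagE D) X
  (fun k l => proj2 (andP (sqrt_diag_bounds D_posdef k l n_gt0))).
by rewrite hs_norm2_re -rmorphM => /re_le.
Qed.

Lemma ip_ge0 X : 0 <= ip X X.
Proof.
by apply: le_trans (ip_ge_hsr X); rewrite mulr_ge0 ?hsr_ge0 // ltW // min_eigenvalue_gt0.
Qed.

Lemma ip_gt0 X : X != 0 -> 0 < ip X X.
Proof.
move=> X0; apply: lt_le_trans (ip_ge_hsr X).
by rewrite mulr_gt0 ?hsr_gt0 // min_eigenvalue_gt0.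
Qed.

Lemma ip_cauchy_schwarz X Y : ip X Y ^+ 2 <= ip X X * ip Y Y.
Proof.
apply: form_cauchy_schwarz => [||//|]; [exact: ipD|exact: ipZ|exact: ipC|exact: ip_ge0].
Qed.

Lemma max_eigenvalue_gt0 : 0 < sp.
Proof.
have := sqrt_diag_bounds D_posdef (Ordinal n_gt0) (Ordinal n_gt0) n_gt0.
move=> /andP[] /le_trans H /H; rewrite lecR; apply: lt_le_trans.
exact: min_eigenvalue_gt0.
Qed.

Lemma linear_ip_bounded (f : {linear M -> M}) :
  exists2 B, 0 <= B & forall X, ip (f X) (f X) <= B * ip X X.
Proof.
have [B B_ge0 bnd] := linear_hsr_bounded f.
have sm0 := min_eigenvalue_gt0 D_posdef n_gt0; have sp0 := max_eigenvalue_gt0.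
exists (sp * B / sm) => [|X]; first by rewrite divr_ge0 ?mulr_ge0 // ltW.
apply: le_trans (ip_le_hsr _) _; rewrite mulrAC ler_pdivlMr //.
rewrite -!mulrA ler_pM2l //.
apply: le_trans (ler_wpM2r (ltW sm0) (bnd X)) _.
by rewrite -mulrA ler_wpM2l // mulrC ip_ge_hsr.
Qed.

Lemma dirichlet_le_opnorm (f : {linear M -> M}) X :
  ip X (f X) <= kms_opnorm D f * ip X X.
Proof.
have N_sqr Y : kms_norm D Y ^+ 2 = ip Y Y by rewrite sqr_sqrtr ?ip_ge0.
have N_ge0 Y : 0 <= kms_norm D Y by exact: sqrtr_ge0.
have N_gt0 Y : Y != 0 -> 0 < kms_norm D Y by move=> Y0; rewrite sqrtr_gt0 ip_gt0.
have N0 : kms_norm D 0 = 0 by rewrite /kms_norm /kms mulmx0 mul0mx mxtrace0 sqrtr0.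
have [B B_ge0 bnd] := linear_ip_bounded f.
have := @le_opnorm _ _ (kms_norm D) f (Num.sqrt B) X N_gt0 _ N0.
rewrite linear0 N0 => /(_ erefl) H.
have {}H : kms_norm D (f X) <= kms_opnorm D f * kms_norm D X.
  apply: H => Y; rewrite /kms_norm -sqrtrM //; apply: ler_wsqrtr; exact: bnd.
apply: le_trans (ler_norm _) _.
apply: (@le_trans _ _ (kms_norm D X * kms_norm D (f X))).
  rewrite -ler_sqr ?nnegrE ?mulr_ge0 // real_normK ?num_real //.
  by rewrite exprMn (N_sqr X) (N_sqr (f X)); exact: ip_cauchy_schwarz.
by rewrite -N_sqr expr2 mulrCA ler_wpM2l.
Qed.

Lemma kms_opnorm_ge0 (f : M -> M) : 0 <= kms_opnorm D f.
Proof. by apply: opnorm_ge0 => X; exact: sqrtr_ge0. Qed.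

End InnerProduct.
End RealForms.

(** * The Dirichlet form *)

Section Projections.
Context {R : realType} {n : nat}.
Local Notation M := 'M[R[i]]_n.

Lemma l1_normM (A B : M) : l1_norm (A *m B) <= l1_norm A * l1_norm B.
Proof.
rewrite {1 2}/l1_norm mulr_suml; apply: ler_sum => i _.
apply: (@le_trans _ _ (\sum_j \sum_k cabs (A i k) * cabs (B k j))).
  apply: ler_sum => j _; rewrite mxE; apply: le_trans (cabs_sum _) _.
  by apply: ler_sum => k _; rewrite cabsM.
rewrite exchange_big mulr_suml; apply: ler_sum => k _; rewrite -mulr_sumr.
rewrite ler_wpM2l ?cabs_ge0 // /l1_norm [X in _ <= X](bigD1 k) //= lerDl.
by do 2 (apply: sumr_ge0 => ? _); exact: cabs_ge0.
Qed.

(** The l1 norm is submultiplicative, hence at least 1 on a nonzero idempotent. The constant is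
    crude, as it only serves the positivity of the conductance. *)
Lemma idempotent_hsr_ge1 (P : M) : P *m P = P -> P != 0 -> 1 <= n%:R ^+ 4 * hsr P.
Proof.
move=> PP P0.
have l1_gt0 : 0 < l1_norm P.
  rewrite lt_neqAle l1_norm_ge0 andbT eq_sym; apply: contra P0 => /eqP l10.
  apply/eqP/matrixP => i j; rewrite mxE; apply: cabs0_eq0.
  by apply/eqP; rewrite eq_le cabs_ge0 andbT -l10 cabs_le_l1.
have l1_ge1 : 1 <= l1_norm P.
  by rewrite -(ler_pM2l l1_gt0) mulr1 -{1}PP l1_normM.
have : 1 <= n%:R ^+ 2 * Num.sqrt (hsr P) := le_trans l1_ge1 (l1_le_hsr P).
have -> : n%:R ^+ 4 * hsr P = (n%:R ^+ 2 * Num.sqrt (hsr P)) ^+ 2.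
  by rewrite exprMn sqr_sqrtr ?hsr_ge0 // -exprM.
by move=> H; rewrite -[X in X <= _](expr1n _ 2) lerXn2r ?nnegrE // (le_trans _ H).
Qed.

Lemma hsrZ c (X : M) : hsr (c *: X) = cabs c ^+ 2 * hsr X.
Proof.
rewrite /hsr mulr_sumr; apply: eq_bigr => i _; rewrite mulr_sumr.
by apply: eq_bigr => j _; rewrite mxE cabsM exprMn.
Qed.

(** The pieces (1 - c) P and - c (1 - P) are orthogonal, and |1 - c| + |c| >= 1 forces the sum of
    the squares to be at least 1/2. Nontrivial projections thus stay away from the scalars. *)
Lemma projection_sub_scalar (P : M) c : orthogonal_projection P ->
  P != 0 -> P != 1%:M -> 1 / 2 <= n%:R ^+ 4 * hsr (P - c *: 1%:M).
Proof.
move=> [/hermP P_herm PP] P0 P1.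
have QQ : (1%:M - P) *m (1%:M - P) = 1%:M - P.
  by rewrite mulmxBl !mulmxBr !mul1mx !mulmx1 PP subrr subr0.
have Q0 : 1%:M - P != 0 by rewrite subr_eq0 eq_sym.
have -> : hsr (P - c *: 1%:M) = cabs (1 - c) ^+ 2 * hsr P + cabs c ^+ 2 * hsr (1%:M - P).
  apply: complexI; rewrite -hs_norm2_re (hs_norm2_proj _ P_herm PP) !hs_norm2_re.
  rewrite -rmorphD; congr (_ + _)%:C.
    by rewrite -hsrZ mulmxBr PP -scalemxAr mulmx1 scalerBl scale1r.
  rewrite -[cabs c]cabsN -hsrZ mulmxBr mulmxBl mul1mx PP subrr sub0r.
  by rewrite -scalemxAr mulmx1 scaleNr.
have h1 := idempotent_hsr_ge1 PP P0; have h2 := idempotent_hsr_ge1 QQ Q0.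
rewrite mulrDr ![_ * (cabs _ ^+ 2 * _)]mulrCA.
have := ler_wpM2l (sqr_ge0 (cabs (1 - c))) h1.
have := ler_wpM2l (sqr_ge0 (cabs c)) h2.
have : 1 <= cabs (1 - c) + cabs c.
  apply: le_trans (cabsD _ _); rewrite subrK.
  by rewrite -[1 in X in _ <= X]/(1%:C) cabs_real normr1.
have := cabs_ge0 c; have := cabs_ge0 (1 - c); rewrite !mulr1.
set u := cabs (1 - c); set v := cabs c => u0 v0 uv hv hu.
have : 1 / 2 <= u ^+ 2 + v ^+ 2.
  by have := sqr_ge0 (u - v); rewrite !expr2; nra.
by move=> /le_trans; apply; rewrite lerD.
Qed.

(** In finite dimension the inverse is again a linear endomorphism, hence bounded. *)
Lemma injective_hsr_bounded (f : {linear M -> M}) : (forall X, f X = 0 -> X = 0) ->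
  exists2 B, 0 <= B & forall X, hsr X <= B * hsr (f X).
Proof.
move=> f_inj; have [B B_ge0 bnd] := linear_hsr_bounded (linfun f)^-1%VF.
exists B => // X.
suff E : ((linfun f)^-1)%VF (f X) = X by rewrite -[X in hsr X <= _]E; exact: bnd.
rewrite -[f X](lfunE f) lker0_lfunK //.
apply/lker0P => Y Z; rewrite !lfunE => /eqP; rewrite -subr_eq0 -linearB.
by move=> /eqP/f_inj/eqP; rewrite subr_eq0 => /eqP.
Qed.

End Projections.

(** * The semigroup at small times and the Dirichlet form of its generator *)

Section Dynamics.
Context {R : realType} {n : nat}.
Local Notation M := 'M[R[i]]_n.
Variables (Phi : R -> {linear M -> M}) (L : {linear M -> M}) (D : M).
Hypothesis n_gt0 : (0 < n)%N.
Hypothesis Phi_qms : quantum_markov_semigroup Phi.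
Hypothesis L_gen : is_generator Phi L.
Hypothesis D_posdef : posdefmx D.
Hypothesis Phi_sym : kms_symmetric D Phi.
Local Notation ip := (ip D).
Local Notation sm := (min_eigenvalue D).
Local Notation sp := (max_eigenvalue D).

Lemma qms_psd_blocks t k (A : 'I_k -> 'I_k -> M) : 0 <= t ->
  psd_blocks A -> psd_blocks (fun p q => Phi t (A p q)).
Proof. by move=> t0 /psd_mxblockP/(qms_cp Phi_qms t0)/psd_mxblockP. Qed.

Lemma dirichlet_limit X Y : exists2 K, 0 <= K & forall t, 0 < t -> t <= 1 ->
  `|ip Y (X - Phi t X) - t * ip Y (L X)| <= K * t ^+ 2.
Proof.
have [A A_ge0 bnd] := ip_l1 D Y; have [K K_ge0 taylor] := generator_taylor X L_gen.
exists (A * K) => [|t t_gt0 t_le1]; first exact: mulr_ge0.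
rewrite -ipZ -ipB addrAC -mulrA; apply: le_trans (bnd _) _.
by rewrite ler_wpM2l // taylor.
Qed.

(** The commutator formula makes <X, X - Phi_t X> a sum of squared norms; its first-order term in t
    is the Dirichlet form. *)
Lemma dirichlet_ge0 X : 0 <= ip X (L X).
Proof.
have [K K_ge0 H] := dirichlet_limit X X.
apply: (ge0_of_quadratic_error K_ge0) => t t_gt0 t_le1.
have [I [V VE]] := qms_commutator_form (spectral_unitarymx D)
  (sqrt_diag_gt0 (state_adj D_posdef) (state_pos D_posdef)) (sqrtmx_diagE D)
  (fun k A => @qms_psd_blocks t k A (ltW t_gt0)) (qms_unital Phi_qms (ltW t_gt0))
  (Phi_sym (ltW t_gt0)).
have : 0 <= ip X (X - Phi t X).
  suff : 0 <= kms D X (X - Phi t X) by move/re_le.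
  rewrite kmsE VE; apply: sumr_ge0 => m _.
  apply: le_trans (hs_le_wform (spectral_unitarymx D) (sqrtmx_diagE D) _
    (fun k l => proj1 (andP (sqrt_diag_bounds D_posdef k l n_gt0)))).
  by rewrite mulr_ge0 ?hs_norm2_ge0 // ler0c ltW // min_eigenvalue_gt0.
move=> p_ge0; have := le_trans (ler_norm _) (H t t_gt0 t_le1).
rewrite lerBlDr => /(le_trans p_ge0).
by rewrite -(subr_ge0 (- _)) opprK [t * _ + _]addrC.
Qed.

Lemma dirichlet_sym X Y : ip X (L Y) = ip Y (L X).
Proof.
have [K K_ge0 HK] := dirichlet_limit Y X; have [K' K'_ge0 HK'] := dirichlet_limit X Y.
have main t : 0 < t -> t <= 1 -> `|t * (ip X (L Y) - ip Y (L X))| <= (K + K') * t ^+ 2.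
  move=> t_gt0 t_le1; have H := HK t t_gt0 t_le1; have := HK' t t_gt0 t_le1.
  have -> : ip Y (X - Phi t X) = ip X (Y - Phi t Y).
    rewrite !ipB (ipC D_posdef Y X) (ipC D_posdef Y (Phi t X)); congr (_ - _).
    by rewrite /ip (Phi_sym (ltW t_gt0)).
  move=> H'; rewrite mulrBr mulrDl.
  apply: le_trans (ler_distD (ip X (Y - Phi t Y)) _ _) _.
  by rewrite lerD // distrC.
have KK : 0 <= K + K' by exact: addr_ge0.
apply/eqP; rewrite -subr_eq0 eq_le -oppr_ge0; apply/andP.
split; apply: (ge0_of_quadratic_error KK) => t t_gt0 t_le1.
  by rewrite mulrN lerN2 (le_trans (ler_norm _)) // main.
by have := main t t_gt0 t_le1; rewrite ler_norml => /andP[].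
Qed.

(** The Hermitian matrix with eigenvalue [x a] on the a-th column of the adjoint of W; for an
    indicator x it is a projection. *)
Definition spectral_obs (W : M) (x : 'I_n -> R) : M :=
  W^t* *m diag_mx (\row_a (x a)%:C) *m W.

Lemma graph_comparison (W : M) t : W \is unitarymx -> 0 <= t ->
  exists w : 'I_n -> 'I_n -> R,
    [/\ forall a b, 0 <= w a b, forall a, w a a = 0 &
      forall x, sm * graph_energy w x <=
        ip (spectral_obs W x) (spectral_obs W x - Phi t (spectral_obs W x))
        <= sp * graph_energy w x].
Proof.
move=> W_unitary t_ge0.
have [c [c_ge0 c_diag cE]] := spectral_comparison (spectral_unitarymx D)
  (sqrt_diag_gt0 (state_adj D_posdef) (state_pos D_posdef)) (sqrtmx_diagE D)
  (fun k A => @qms_psd_blocks t k A t_ge0) (qms_unital Phi_qms t_ge0)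
  (Phi_sym t_ge0) W_unitary (fun k l => sqrt_diag_bounds D_posdef k l n_gt0).
exists (fun a b => complex.Re (c a b)); split=> [a b|a|x].
- exact: re_le (c_ge0 a b).
- by rewrite c_diag.
have := cE (\row_a (x a)%:C); cbv zeta.
set T := \sum_a _; have -> : T = (graph_energy (fun a b => complex.Re (c a b)) x)%:C.
  rewrite /T /graph_energy rmorph_sum; apply: eq_bigr => a _.
  rewrite rmorph_sum; apply: eq_bigr => b _ /=.
  rewrite !mxE -rmorphB rmorphM /= RRe_real ?ger0_real // cabsE cabs_real.
  by rewrite rmorphXn /= -rmorphXn real_normK ?num_real // rmorphXn.
by rewrite -!rmorphM => /andP[/re_le H1 /re_le H2]; apply/andP; split.
Qed.

Lemma dirichlet_gap : (forall X, L X = 0 <-> is_scalar_mx X) ->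
  exists2 c, 0 < c & forall P, orthogonal_projection P -> P != 0 -> P != 1%:M ->
    c <= ip P (L P).
Proof.
move=> kerL.
have L1 : L 1%:M = 0 by apply/kerL; exact: scalar_mx_is_scalar.
(* Cauchy-Schwarz for the Dirichlet form between [L X] and X, divided by <L X, L X>: it passes from
   [L X] being bounded below to the energy being bounded below. *)
have L_le X : ip (L X) (L X) <= kms_opnorm D L * ip X (L X).
  have := form_cauchy_schwarz (b := fun X Y => ip X (L Y)).
  move=> /(_ _ _ dirichlet_sym dirichlet_ge0 (L X) X) CS.
  have {}CS : ip (L X) (L X) ^+ 2 <= ip (L X) (L (L X)) * ip X (L X).
    apply: CS => [A B C|s A B]; first by rewrite linearD ipD.
    by rewrite linearZ ipZ.
  have := dirichlet_le_opnorm D_posdef n_gt0 L (L X) => H.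
  have := ip_ge0 D_posdef n_gt0 (L X); rewrite le_eqVlt => /orP[/eqP <-|u_gt0].
    by rewrite mulr_ge0 ?kms_opnorm_ge0 ?dirichlet_ge0.
  rewrite -(ler_pM2l u_gt0) -expr2; apply: le_trans CS _.
  by rewrite [X in _ <= X]mulrCA mulrA; exact: ler_wpM2r (dirichlet_ge0 X) _ _ H.
pose f X := L X + \tr X *: 1%:M.
have f_lin : linear f.
  by move=> a X Y; rewrite /f !linearP /= scalerDl scalerDr scalerA addrACA.
pose g : {linear M -> M} := HB.pack f (GRing.isLinear.Build _ _ _ _ _ f_lin).
have g_inj X : g X = 0 -> X = 0.
  rewrite /= /f => gX0.
  have trX0 : \tr X = 0.
    have ip0 Y : ip Y 0 = 0 by rewrite /ip /kms mulmx0 mul0mx mxtrace0.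
    have one_neq0 : 1%:M != 0 :> M.
      apply/eqP => /matrixP/(_ (Ordinal n_gt0) (Ordinal n_gt0)).
      by rewrite !mxE eqxx => /eqP; rewrite oner_eq0.
    (* Multiplication by the conjugate trace makes the coefficient of 1 real, as [ip] is linear over
       the reals only. Pairing with 1 then kills the image of [L], by symmetry and L 1 = 0. *)
    have E : (cabs (\tr X) ^+ 2)%:C *: 1%:M = - L ((\tr X)^* *: X).
      apply/eqP; rewrite -addr_eq0 linearZ addrC.
      have -> : (cabs (\tr X) ^+ 2)%:C = (\tr X)^* * \tr X.
        by rewrite mulrC -normCK cabsE rmorphXn.
      by rewrite -scalerA -scalerDr gX0 scaler0.
    have := congr1 (ip 1%:M) E; rewrite ipN dirichlet_sym L1 ip0 oppr0 ipZ => /eqP.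
    rewrite mulf_eq0 sqrf_eq0 (gt_eqF (ip_gt0 D_posdef n_gt0 one_neq0)) orbF.
    by move=> /eqP/cabs0_eq0.
  move: gX0; rewrite trX0 scale0r addr0 => /kerL/is_scalar_mxP[a Xa].
  move: trX0; rewrite Xa mxtrace_scalar => /eqP; rewrite mulrn_eq0 eqn0Ngt n_gt0 /=.
  by move/eqP => ->; apply/matrixP => i j; rewrite !mxE mul0rn.
have [B B_ge0 Bbnd] := injective_hsr_bounded g_inj.
have sm_gt0 := min_eigenvalue_gt0 D_posdef n_gt0.
pose K := n%:R ^+ 4 * (B * (kms_opnorm D L / sm)).
have K_ge0 : 0 <= K.
  by rewrite !mulr_ge0 ?exprn_ge0 ?kms_opnorm_ge0 // invr_ge0 ltW.
exists (1 / 2 / (K + 1)) => [|P P_proj P0 P1]; first by rewrite !divr_gt0 // ltr_wpDl.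
rewrite ler_pdivrMr ?ltr_wpDl //.
apply: le_trans (projection_sub_scalar (\tr P / n%:R) P_proj P0 P1) _.
set Y := P - _.
have gY : g Y = L P.
  rewrite /= /f /Y linearB linearZ /= L1 scaler0 subr0.
  rewrite [\tr _]linearB linearZ /= mxtrace1 divfK ?pnatr_eq0 -?lt0n //.
  by rewrite subrr scale0r addr0.
apply: (@le_trans _ _ (K * ip P (L P))); last first.
  by rewrite mulrC ler_wpM2l ?dirichlet_ge0 // lerDl.
rewrite /K -(mulrA (n%:R ^+ 4)) ler_wpM2l ?exprn_ge0 //.
apply: le_trans (Bbnd Y) _; rewrite -(mulrA B).
rewrite ler_wpM2l // gY mulrAC ler_pdivlMr // mulrC.
apply: le_trans (ip_ge_hsr D_posdef n_gt0 _) _.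
exact: L_le.
Qed.

End Dynamics.

(** * Conductance and spectral spread *)

Lemma le_of_small_perturbation (R : realFieldType) (A B l h K : R) :
    0 <= A -> 0 <= B -> 0 <= l -> 0 < h -> 0 < K ->
    (forall t, 0 < t -> t <= 1 -> K * t < h ->
       (h - K * t) ^+ 2 * A <= B * ((l + K * t) * (1 + K * t))) ->
  h ^+ 2 * A <= B * l.
Proof.
move=> A0 B0 l0 h0 K0 H; apply/ler_addgt0Pr => eps eps0.
pose c := 2 * h * K * A + B * K * (1 + l + K).
have c0 : 0 <= c.
  by rewrite addr_ge0 // !mulr_ge0 ?addr_ge0 // ltW.
pose t := Num.min 1 (Num.min (h / (2 * K)) (eps / (c + 1))).
have t0 : 0 < t.
  by rewrite !lt_min ltr01 !divr_gt0 ?mulr_gt0 // ltr_wpDl.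
have t1 : t <= 1 by rewrite ge_min lexx.
have tK : K * t < h.
  have : t <= h / (2 * K) by rewrite !ge_min lexx orbT.
  rewrite ler_pdivlMr ?mulr_gt0 // => tK.
  by apply: lt_le_trans (_ : t * (2 * K) <= h); nra.
have tc : t * (c + 1) <= eps.
  by rewrite -ler_pdivlMr ?ltr_wpDl // !ge_min lexx !orbT.
have ct : t * c <= eps by nra.
have := H t t0 t1 tK => Ht.
have : h ^+ 2 * A <= B * l + t * c; last by move=> ?; lra.
have tt : K * t * (K * t) * B <= B * K * K * t.
  have : t * t <= t by nra.
  move=> tt; rewrite [X in X <= _](_ : _ = (K * K * B) * (t * t)); last by ring.
  rewrite [X in _ <= X](_ : _ = (K * K * B) * t); last by ring.
  by rewrite ler_wpM2l // !mulr_ge0 // ltW.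
have pos : 0 <= K * t * (K * t) * A by rewrite !mulr_ge0 // ltW.
move: Ht; rewrite /c; move: tt pos; rewrite !expr2; lra.
Qed.

Lemma re_add (R : realType) (x y : R[i]) :
  complex.Re (x + y) = complex.Re x + complex.Re y.
Proof. by case: x y => [? ?] [? ?]. Qed.

Section Conductance.
Context {R : realType} {n : nat}.
Local Notation M := 'M[R[i]]_n.
Variables (Phi : R -> {linear M -> M}) (L : {linear M -> M}) (D : M).
Hypothesis n_gt0 : (0 < n)%N.
Hypothesis Phi_qms : quantum_markov_semigroup Phi.
Hypothesis L_gen : is_generator Phi L.
Hypothesis D_faithful : faithful_state D.
Hypothesis Phi_sym : kms_symmetric D Phi.
Local Notation ip := (ip D).
Local Notation sm := (min_eigenvalue D).
Local Notation sp := (max_eigenvalue D).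
Local Notation h := (conductance D L).
Local Notation prob X := (complex.Re (state D X)).

Let D_posdef : posdefmx D := proj1 D_faithful.
Let sm_gt0 : 0 < sm := min_eigenvalue_gt0 D_posdef n_gt0.
Let sp_gt0 : 0 < sp := max_eigenvalue_gt0 D_posdef n_gt0.

Lemma prob1 : prob 1%:M = 1.
Proof. by rewrite /state mulmx1 (proj2 D_faithful). Qed.

Lemma probB X Y : prob (X - Y) = prob X - prob Y.
Proof.
rewrite /state mulmxBr linearB /=.
by case: (\tr (D *m X)) (\tr (D *m Y)) => [? ?] [? ?].
Qed.

Lemma ip_proj_le P : orthogonal_projection P -> ip P P <= prob P.
Proof.
move=> [/hermP P_herm PP].
have := wform_proj_le (sqrtmx_adj D_posdef) P_herm PP.
by rewrite sqrtmx_sqr // => /re_le.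
Qed.

Lemma projC (P : M) : orthogonal_projection P -> orthogonal_projection (1%:M - P).
Proof.
move=> [/hermP P_herm PP]; split.
  by apply/hermP; rewrite trmxCB trmxC1 P_herm.
by rewrite mulmxBl !mulmxBr !mul1mx !mulmx1 PP subrr subr0.
Qed.

Lemma prob_gt0 P : orthogonal_projection P -> P != 0 -> 0 < prob P.
Proof.
by move=> P_proj P0; apply: lt_le_trans (ip_gt0 D_posdef n_gt0 P0) (ip_proj_le P_proj).
Qed.

Lemma prob_lt1 P : orthogonal_projection P -> P != 1%:M -> 0 < 1 - prob P.
Proof.
move=> P_proj P1; rewrite -prob1 -probB; apply: prob_gt0; first exact: projC.
by rewrite subr_eq0 eq_sym.
Qed.

Lemma min_prob_gt0 P : orthogonal_projection P -> P != 0 -> P != 1%:M ->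
  0 < Num.min (prob P) (1 - prob P).
Proof. by move=> P_proj P0 P1; rewrite lt_min prob_gt0 // prob_lt1. Qed.

Lemma min_prob_le P : Num.min (prob P) (1 - prob P) <= 1 / 2.
Proof. by rewrite ge_min; case: (leP (prob P) (1 / 2)) => //= H; lra. Qed.

Lemma conductance_le P : orthogonal_projection P -> P != 0 -> P != 1%:M ->
  h * Num.min (prob P) (1 - prob P) <= ip P (L P).
Proof.
move=> P_proj P0 P1; rewrite -ler_pdivlMr ?min_prob_gt0 //.
apply: ge_inf; last by exists P.
exists 0 => _ [Q /= [Q_proj Q0 Q1] <-].
apply: divr_ge0; last exact/ltW/min_prob_gt0.
exact: (dirichlet_ge0 n_gt0 Phi_qms L_gen D_posdef Phi_sym).
Qed.

Lemma le_conductance c : (1 < n)%N ->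
    (forall P, orthogonal_projection P -> P != 0 -> P != 1%:M ->
       c * Num.min (prob P) (1 - prob P) <= ip P (L P)) -> c <= h.
Proof.
move=> n_gt1 c_le; apply: lb_le_inf; last first.
  move=> _ [P [P_proj P0 P1] <-]; rewrite ler_pdivlMr ?min_prob_gt0 //.
  exact: c_le.
pose o := Ordinal n_gt0; pose o' := Ordinal n_gt1.
pose P : M := delta_mx o o.
eexists; exists P => //; split.
- split; last by rewrite /P mul_delta_mx.
  by apply/hermP/matrixP => i j; rewrite !mxE rmorph_nat andbC.
- apply/eqP => /matrixP/(_ o o); rewrite !mxE !eqxx => /eqP; by rewrite oner_eq0.
- apply/eqP => /matrixP/(_ o' o'); rewrite !mxE !eqxx => /eqP.
  by rewrite eq_sym oner_eq0.
Qed.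

Lemma conductance_gt0 : (1 < n)%N -> (forall X, L X = 0 <-> is_scalar_mx X) -> 0 < h.
Proof.
move=> n_gt1 kerL.
have [c c_gt0 c_le] := dirichlet_gap n_gt0 Phi_qms L_gen D_posdef Phi_sym kerL.
apply: (lt_le_trans c_gt0); apply: le_conductance => // P P_proj P0 P1.
apply: le_trans (c_le P P_proj P0 P1); apply: ler_piMr; first exact: ltW.
by apply: le_trans (min_prob_le P) _; lra.
Qed.

Section SpectralProjections.
Variable W : M.
Hypothesis W_unitary : W \is unitarymx.

Definition weight a : R := complex.Re ((W *m D *m W^t*) a a).

Lemma weight_ge a : sm <= weight a.
Proof.
have := posdef_diag_ge (state_adj D_posdef) a W_unitary (min_eigenvalue_le D_posdef).
by move/re_le.
Qed.

Lemma prob_spectral_obs x : prob (spectral_obs W x) = \sum_a weight a * x a.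
Proof.
rewrite /state mxtrace_diag_conj; elim/big_rec2: _ => // a u z _ <-.
by rewrite [(\row_ _ _) _ _]mxE re_add [_ * (x a)%:C]mulrC re_scale mulrC.
Qed.

Lemma prob_indicator S :
  prob (spectral_obs W (set_indicator S)) = \sum_(a in S) weight a.
Proof.
rewrite prob_spectral_obs [RHS]big_mkcond; apply: eq_bigr => a _.
by rewrite /set_indicator; case: ifP => _; rewrite ?mulr1 ?mulr0.
Qed.

Lemma spectral_obs_proj S : orthogonal_projection (spectral_obs W (set_indicator S)).
Proof.
split.
  by apply/hermP/adj_mul_diag => k; rewrite mxE; apply/complex_realP; eexists.
rewrite /spectral_obs; have /unitarymxP WW := W_unitary.
rewrite -!mulmxA (mulmxA W) WW mul1mx (mulmxA (diag_mx _)); congr (_ *m (_ *m _)).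
rewrite mulmx_diag; congr diag_mx; apply/rowP => a; rewrite !mxE -rmorphM.
by rewrite /set_indicator; case: (a \in S); rewrite ?mulr1 ?mulr0.
Qed.

Lemma sum_weight : \sum_a weight a = 1.
Proof.
rewrite -prob1; have <- : spectral_obs W (fun=> 1) = 1%:M.
  rewrite /spectral_obs (_ : diag_mx _ = 1%:M) ?mulmx1 ?unitarymxV //.
  by apply/matrixP => i j; rewrite !mxE.
by rewrite prob_spectral_obs; apply: eq_bigr => a _; rewrite mulr1.
Qed.

Lemma indicator_iso (S : {set 'I_n}) :
  h * Num.min (\sum_(a in S) weight a) (1 - \sum_(a in S) weight a) <=
  ip (spectral_obs W (set_indicator S)) (L (spectral_obs W (set_indicator S))).
Proof.
have e_ge0 := dirichlet_ge0 n_gt0 Phi_qms L_gen D_posdef Phi_sym.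
rewrite -prob_indicator; set P := spectral_obs _ _.
have prob0 : prob 0 = 0 by rewrite /state mulmx0 mxtrace0.
have [->|P0] := eqVneq P 0.
  by rewrite prob0 (min_idPl _) ?subr0 // mulr0 e_ge0.
have [->|P1] := eqVneq P 1%:M.
  by rewrite prob1 subrr (min_idPr _) // mulr0 e_ge0.
exact: conductance_le (spectral_obs_proj S) P0 P1.
Qed.

Lemma weight_set_ge (S : {set 'I_n}) : S != finset.set0 -> sm <= \sum_(a in S) weight a.
Proof.
case/set0Pn => a aS; rewrite (bigD1 a) //=.
apply: le_trans (weight_ge a) _; rewrite lerDl sumr_ge0 // => b _.
exact: le_trans (ltW sm_gt0) (weight_ge b).
Qed.

Lemma weight_min_ge (S : {set 'I_n}) :
  let m := Num.min (\sum_(a in S) weight a) (1 - \sum_(a in S) weight a) in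
  m = 0 \/ sm <= m.
Proof.
cbv zeta; have -> : 1 - \sum_(a in S) weight a = \sum_(a in ~: S) weight a.
  rewrite -sum_weight [X in X - _](bigID (mem S)) /= [X in X - _]addrC addrK.
  by apply: eq_bigl => a; rewrite inE.
have [->|S0] := eqVneq S finset.set0.
  left; rewrite big_set0 (min_idPl _) // sumr_ge0 // => a _.
  exact: le_trans (ltW sm_gt0) (weight_ge a).
have [->|S1] := eqVneq (~: S) finset.set0.
  left; rewrite big_set0 (min_idPr _) // sumr_ge0 // => a _.
  exact: le_trans (ltW sm_gt0) (weight_ge a).
by right; rewrite le_min !weight_set_ge.
Qed.

Lemma spectral_spread x a b : 0 < h ->
  ip (spectral_obs W x) (L (spectral_obs W x)) <= 1 ->
  h ^+ 2 * (sm ^+ 3 * (x a - x b) ^+ 2) <= 4 * sp ^+ 2 * kms_opnorm D L.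
Proof.
move=> h_gt0; set X := spectral_obs W x => eX_le1.
have Lam_ge0 := kms_opnorm_ge0 D L; set Lam := kms_opnorm D L in Lam_ge0 *.
pose e Y := ip Y (L Y); pose et t Y := ip Y (Y - Phi t Y).
pose P S := spectral_obs W (set_indicator S).
have [KX KX_ge0 HX] := dirichlet_limit D L_gen X X.
have /choice[KS HKS] (S : {set 'I_n}) : exists K, 0 <= K /\ forall t, 0 < t -> t <= 1 ->
    `|et t (P S) - t * e (P S)| <= K * t ^+ 2.
  by have [K K_ge0 HK] := dirichlet_limit D L_gen (P S) (P S); exists K.
pose K := KX + \sum_S KS S + 1.
have KS_ge0 S : 0 <= KS S by have [] := HKS S.
have sumKS_ge0 : 0 <= \sum_S KS S by exact: sumr_ge0.
have K_gt0 : 0 < K by rewrite ltr_wpDl // addr_ge0.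
have etX t : 0 < t -> t <= 1 -> et t X <= t * (1 + K * t).
  move=> t0 t1; have := le_trans (ler_norm _) (HX t t0 t1).
  rewrite lerBlDr => /le_trans; apply.
  have -> : t * (1 + K * t) = K * t ^+ 2 + t by ring.
  apply: lerD; last by rewrite -[X in _ <= X]mulr1 ler_pM2l.
  by rewrite ler_wpM2r ?sqr_ge0 // /K -addrA lerDl addr_ge0.
have etP t S : 0 < t -> t <= 1 -> `|et t (P S) - t * e (P S)| <= t * (K * t).
  move=> t0 t1; have [_ /(_ t t0 t1)] := HKS S; move/le_trans; apply.
  have -> : t * (K * t) = K * t ^+ 2 by ring.
  rewrite ler_wpM2r ?sqr_ge0 // /K (bigD1 S) //=.
  by rewrite addrCA -addrA lerDl !addr_ge0 // sumr_ge0.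
pose K' := K + K / sm.
have Ksm : K <= K' * sm.
  rewrite /K' mulrDl divfK ?gt_eqF // lerDr mulr_ge0 //; exact: ltW.
have K'_ge : K <= K' by rewrite /K' lerDl divr_ge0 // ltW.
have K'_gt0 : 0 < K' := lt_le_trans K_gt0 K'_ge.
apply: (le_of_small_perturbation (K := K')) => //.
- by rewrite mulr_ge0 ?sqr_ge0 // exprn_ge0 // ltW.
- by rewrite mulr_ge0 ?sqr_ge0.
move=> t t0 t1 tK.
have [w [w_ge0 w_diag wE]] :=
  graph_comparison n_gt0 Phi_qms D_posdef Phi_sym W_unitary (ltW t0).
pose kappa := t * (h - K' * t) / sp; pose beta := t * (Lam + K' * t) / sm.
have kappa_gt0 : 0 < kappa by rewrite divr_gt0 // mulr_gt0 // subr_gt0.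
have beta_gt0 : 0 < beta by rewrite divr_gt0 // mulr_gt0 // ltr_wpDl // mulr_gt0.
have energy_ge0 f : 0 <= graph_energy w f.
  by do 2 (apply: sumr_ge0 => ? _); rewrite mulr_ge0 ?sqr_ge0.
have iso (S : {set 'I_n}) :
    kappa * Num.min (\sum_(c in S) weight c) (1 - \sum_(c in S) weight c) <=
    graph_energy w (set_indicator S).
  have := indicator_iso S; case: (weight_min_ge S) => [-> _|]; first by rewrite mulr0.
  set m := Num.min _ _ => sm_le Hiso.
  rewrite /kappa mulrAC ler_pdivrMr // [_ * sp]mulrC.
  have /andP[_ /(le_trans _)] := wE (set_indicator S); apply.
  have := etP t S t0 t1; rewrite ler_norml => /andP[low _].
  have {}Hiso := ler_wpM2l (ltW t0) Hiso.
  have Kt : t * (K * t) <= t * (K' * t * m).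
    rewrite ler_pM2l // mulrAC ler_pM2r //; apply: le_trans Ksm _.
    by rewrite ler_pM2l.
  rewrite -/(P S) -/(et t _) -/(e _) in low Hiso *.
  move: low Hiso Kt; move: (et t (P S)) (e (P S)) => p q; lra.
have deg c : graph_energy w (set_indicator [set c]) <= beta * weight c.
  rewrite /beta mulrAC ler_pdivlMr // [_ * sm]mulrC.
  have /andP[/le_trans + _] := wE (set_indicator [set c]); apply.
  have := etP t [set c]%SET t0 t1; rewrite ler_norml => /andP[_ up].
  have eP_le : e (P [set c]%SET) <= Lam * weight c.
    apply: le_trans (dirichlet_le_opnorm D_posdef n_gt0 L _) _.
    rewrite ler_wpM2l //; apply: le_trans (ip_proj_le (spectral_obs_proj _)) _.
    by rewrite prob_indicator big_set1.
  have Kt : t * (K * t) <= t * (K' * t * weight c).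
    rewrite ler_pM2l // mulrAC ler_pM2r //; apply: le_trans Ksm _.
    by rewrite ler_pM2l // weight_ge.
  have {}eP_le := ler_wpM2l (ltW t0) eP_le.
  rewrite -/(P [set c]%SET) -/(et t _) in up *.
  move: up eP_le Kt; move: (et t _) (e _) (weight c) => p q v; lra.
have spread := cheeger_spread x w_ge0 w_diag (ltW sm_gt0) weight_ge sum_weight
  kappa_gt0 beta_gt0 iso deg a b.
have energy_le : graph_energy w x <= t * (1 + K' * t) / sm.
  rewrite ler_pdivlMr // mulrC.
  have /andP[/le_trans + _] := wE x; apply; apply: le_trans (etX t t0 t1) _.
  by rewrite ler_pM2l // lerD2l ler_pM2r.
have := le_trans spread (ler_wpM2l (mulr_ge0 (ler0n R 4) (ltW beta_gt0)) energy_le).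
have c_gt0 : 0 < t ^+ 2 / (sp ^+ 2 * sm ^+ 2).
  by rewrite divr_gt0 ?mulr_gt0 ?exprn_gt0.
move=> H; rewrite -(ler_pM2l c_gt0); move: H; rewrite /kappa /beta.
have sp_neq0 : sp != 0 by rewrite gt_eqF.
have sm_neq0 : sm != 0 by rewrite gt_eqF.
by congr (_ <= _); field; rewrite sp_neq0 sm_neq0.
Qed.

End SpectralProjections.
End Conductance.

(** * The diameter *)

Section Densities.
Context {R : realType} {n : nat}.
Local Notation M := 'M[R[i]]_n.

Lemma herm_spectral_obs (X : M) : X \is hermsymmx ->
  X = spectral_obs (spectralmx X) (fun a => complex.Re (spectral_diag X 0 a)).
Proof.
move=> /hermP X_herm; rewrite /spectral_obs.
have <- : spectral_diag X = \row_a (complex.Re (spectral_diag X 0 a))%:C.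
  by apply/rowP => a; rewrite mxE RRe_real // spectral_diag_real.
exact: spectral_herm.
Qed.

Lemma density_mean (E W : M) : density E -> W \is unitarymx ->
  exists p : 'I_n -> R, [/\ forall a, 0 <= p a, \sum_a p a = 1 &
    forall x, \tr (E *m spectral_obs W x) = (\sum_a p a * x a)%:C].
Proof.
move=> [[_ E_psd] trE] W_unitary.
have E_ge0 a : 0 <= (W *m E *m W^t*) a a by rewrite diag_conj_quad.
pose p a := complex.Re ((W *m E *m W^t*) a a).
have pE a : (W *m E *m W^t*) a a = (p a)%:C by rewrite RRe_real // ger0_real.
have meanE x : \tr (E *m spectral_obs W x) = (\sum_a p a * x a)%:C.
  rewrite mxtrace_diag_conj rmorph_sum; apply: eq_bigr => a _.
  by rewrite pE [(\row_ _ _) _ _]mxE rmorphM.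
exists p; split=> // [a|]; first exact: re_le (E_ge0 a).
apply: complexI; rewrite (_ : 1%:C = \tr (E *m 1%:M)); last by rewrite mulmx1 trE.
have <- : spectral_obs W (fun=> 1) = 1%:M.
  rewrite /spectral_obs (_ : diag_mx _ = 1%:M) ?mulmx1 ?unitarymxV //.
  by apply/matrixP => i j; rewrite !mxE.
by rewrite meanE; congr _%:C; apply: eq_bigr => a _; rewrite mulr1.
Qed.

Lemma density_diff_le (D1 D2 W : M) x F : density D1 -> density D2 ->
    W \is unitarymx -> (forall a b, `|x a - x b| <= F) ->
  cabs (\tr ((D1 - D2) *m spectral_obs W x)) <= F.
Proof.
move=> D1_density D2_density W_unitary x_le.
have [p [p_ge0 p1 pE]] := density_mean D1_density W_unitary.
have [q [q_ge0 q1 qE]] := density_mean D2_density W_unitary.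
rewrite mulmxBl linearB /= pE qE -rmorphB cabs_real.
have -> : \sum_a p a * x a - \sum_a q a * x a =
          \sum_a \sum_b p a * q b * (x a - x b).
  transitivity (\sum_a \sum_b p a * q b * x a - \sum_a \sum_b p a * q b * x b).
    congr (_ - _).
      by apply: eq_bigr => a _; rewrite -!mulr_suml -mulr_sumr q1 mulr1.
    rewrite exchange_big; apply: eq_bigr => b _ /=.
    by rewrite -mulr_suml -mulr_suml p1 mul1r.
  rewrite -sumrB; apply: eq_bigr => a _; rewrite -sumrB.
  by apply: eq_bigr => b _; rewrite mulrBr.
apply: le_trans (ler_norm_sum _ _ _) _.
have -> : F = \sum_a \sum_b p a * q b * F.
  under eq_bigr => a _ do rewrite -mulr_suml -mulr_sumr q1 mulr1.
  by rewrite -mulr_suml p1 mul1r.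
apply: ler_sum => a _; apply: le_trans (ler_norm_sum _ _ _) _.
apply: ler_sum => b _; rewrite normrM ger0_norm ?mulr_ge0 //.
by rewrite ler_wpM2l ?mulr_ge0.
Qed.

Lemma projection_density (P : M) : orthogonal_projection P -> P != 0 ->
  density ((hsr P)^-1%:C *: P).
Proof.
move=> [/hermP P_herm PP] P0; have q_gt0 := hsr_gt0 P0.
split; [split|].
- by apply/hermP; rewrite trmxCZ P_herm conj_Creal //; apply/complex_realP; eexists.
- move=> v; rewrite -scalemxAr -scalemxAl mxE mulr_ge0 //.
    by rewrite ler0c invr_ge0 ltW.
  have -> : v^t* *m P *m v = (P *m v)^t* *m (P *m v).
    by rewrite trmxC_mul P_herm mulmxA -(mulmxA _ P P) PP.
  by rewrite mulmx_adj_self sumr_ge0 // => i _; rewrite exprn_ge0.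
rewrite linearZ /=; have -> : \tr P = (hsr P)%:C.
  by rewrite -hs_norm2_re hs_norm2E P_herm PP.
by rewrite -rmorphM mulVf // gt_eqF.
Qed.

End Densities.

Section Diameter.
Context {R : realType} {n : nat}.
Local Notation M := 'M[R[i]]_n.
Variables (Phi : R -> {linear M -> M}) (L : {linear M -> M}) (D : M).
Hypothesis n_ge2 : (2 <= n)%N.
Hypothesis Phi_qms : quantum_markov_semigroup Phi.
Hypothesis L_gen : is_generator Phi L.
Hypothesis L_ker : forall X, L X = 0 <-> is_scalar_mx X.
Hypothesis D_faithful : faithful_state D.
Hypothesis Phi_sym : kms_symmetric D Phi.
Local Notation h := (conductance D L).
Local Notation sm := (min_eigenvalue D).
Local Notation sp := (max_eigenvalue D).

Let n_gt0 : (0 < n)%N := ltnW n_ge2.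
Let h_gt0 : 0 < h :=
  conductance_gt0 n_gt0 Phi_qms L_gen D_faithful Phi_sym n_ge2 L_ker.

Lemma diam_upper : (diam_L D L <=
  (2 * sp / (sm * h) * Num.sqrt (kms_opnorm D L / sm))%:E)%E.
Proof.
have sm_gt0 := min_eigenvalue_gt0 (proj1 D_faithful) n_gt0.
have sp_gt0 := max_eigenvalue_gt0 (proj1 D_faithful) n_gt0.
have Lam_ge0 := kms_opnorm_ge0 D L.
apply: ge_ereal_sup => _ [D1 D1_density [D2 D2_density <-]].
apply: ge_ereal_sup => _ [X /= [X_herm eX] <-]; rewrite lee_fin.
rewrite (herm_spectral_obs X_herm) in eX *; set x := fun _ => _ in eX *.
apply: density_diff_le => // [|a b]; first exact: spectral_unitarymx.
have := spectral_spread n_gt0 Phi_qms L_gen D_faithful Phi_sym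
  (spectral_unitarymx X) a b h_gt0 eX.
move: (kms_opnorm D L) Lam_ge0 (x a - x b) => Lam Lam_ge0 y spread.
have F_ge0 : 0 <= 2 * sp / (sm * h) * Num.sqrt (Lam / sm).
  by rewrite mulr_ge0 ?sqrtr_ge0 // divr_ge0 ?mulr_ge0 // ltW.
rewrite -ler_sqr ?nnegrE // real_normK ?num_real // exprMn sqr_sqrtr; last first.
  by rewrite divr_ge0 // ltW.
have c_gt0 : 0 < h ^+ 2 * sm ^+ 3 by rewrite mulr_gt0 ?exprn_gt0.
rewrite -(ler_pM2l c_gt0) -[X in X <= _](mulrA (h ^+ 2)); apply: le_trans spread _.
rewrite le_eqVlt; apply/orP; left; apply/eqP; field.
by rewrite !gt_eqF.
Qed.

Lemma diam_ge_projection (P : M) : orthogonal_projection P -> P != 0 -> P != 1%:M ->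
  ((Num.sqrt (dirichlet_form D L P))^-1%:E <= diam_L D L)%E.
Proof.
move=> P_proj P0 P1; have Q_proj := projC P_proj.
have Q0 : 1%:M - P != 0 by rewrite subr_eq0 eq_sym.
have [/hermP P_herm PP] := P_proj.
have e_gt0 : 0 < dirichlet_form D L P.
  apply: lt_le_trans (conductance_le n_gt0 Phi_qms L_gen D_faithful Phi_sym P_proj P0 P1).
  by rewrite mulr_gt0 // (min_prob_gt0 n_gt0 D_faithful).
set s := Num.sqrt _; have s_gt0 : 0 < s by rewrite sqrtr_gt0.
apply: le_trans (_ : dist_L D L ((hsr P)^-1%:C *: P)
                      ((hsr (1%:M - P))^-1%:C *: (1%:M - P)) <= _)%E; last first.
  apply: ereal_sup_ubound; exists ((hsr P)^-1%:C *: P); first exact: projection_density.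
  by eexists; [exact: projection_density Q_proj Q0|].
apply: ereal_sup_ubound; exists (s^-1%:C *: P).
  split.
    by apply/hermP; rewrite trmxCZ P_herm conj_Creal //; apply/complex_realP; eexists.
  rewrite /dirichlet_form -/(ip D _ _) linearZ ipZ ipC; last by case: D_faithful.
  rewrite ipZ ipC; last by case: D_faithful.
  rewrite -/(dirichlet_form D L P) mulrA -expr2 exprVn sqr_sqrtr ?(ltW e_gt0) //.
  by rewrite mulVf // gt_eqF.
rewrite -scalemxAr mulmxBl -!scalemxAl PP mulmxBl mul1mx PP subrr scaler0 subr0.
have [_ tr1] := projection_density P_proj P0.
rewrite mxtraceZ tr1 mulr1 -[complex.Re _]/(cabs _) cabs_real.
by rewrite ger0_norm // invr_ge0 ltW.
Qed.

Lemma diam_lower : ((Num.sqrt (2 / h))%:E <= diam_L D L)%E.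
Proof.
have lower := diam_ge_projection.
have inf_ne : ([set dirichlet_form D L P /
             Num.min (complex.Re (state D P)) (1 - complex.Re (state D P))
      | P in [set P : M | [/\ orthogonal_projection P, P != 0 & P != 1%:M]]] !=set0)%classic.
  apply: contrapT => no; move: h_gt0; rewrite /conductance inf_out ?ltxx // => -[] //.
have [_ [P0 [P0_proj P00 P01] _]] := inf_ne.
case E : (diam_L D L) (lower) => [d| |] {}lower; rewrite ?leey //; last first.
  by have := lower _ P0_proj P00 P01.
rewrite lee_fin.
have e_gt0 P : orthogonal_projection P -> P != 0 -> P != 1%:M ->
    0 < dirichlet_form D L P.
  move=> P_proj Pn0 Pn1.
  apply: lt_le_trans (conductance_le n_gt0 Phi_qms L_gen D_faithful Phi_sym P_proj Pn0 Pn1).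
  by rewrite mulr_gt0 // (min_prob_gt0 n_gt0 D_faithful).
have d_gt0 : 0 < d.
  have := lower _ P0_proj P00 P01; rewrite lee_fin; apply: lt_le_trans.
  by rewrite invr_gt0 sqrtr_gt0 e_gt0.
rewrite -[d]ger0_norm ?(ltW d_gt0) // -sqrtr_sqr ler_wsqrtr // ler_pdivrMr //.
rewrite mulrC -ler_pdivrMr ?exprn_gt0 //.
apply: (le_conductance n_gt0 D_faithful n_ge2) => P P_proj Pn0 Pn1.
have := lower _ P_proj Pn0 Pn1; rewrite lee_fin => dP.
have eP := e_gt0 P P_proj Pn0 Pn1.
have one_le : 1 <= d ^+ 2 * dirichlet_form D L P.
  have : 1 <= d * Num.sqrt (dirichlet_form D L P).
    by rewrite -ler_pdivrMr ?sqrtr_gt0 // mul1r.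
  rewrite -{2}[dirichlet_form D L P]sqr_sqrtr ?(ltW eP) // -exprMn => H.
  by rewrite -[X in X <= _](expr1n _ 2) lerXn2r ?nnegrE // (le_trans _ H).
rewrite mulrAC ler_pdivrMr ?exprn_gt0 // [_ * d ^+ 2]mulrC.
apply: le_trans one_le; have := min_prob_le D P; lra.
Qed.

End Diameter.

Theorem theorem3p9 (R : realType) (n : nat) (n_ge2 : (2 <= n)%N)
    (Phi : R -> {linear 'M[R[i]]_n -> 'M[R[i]]_n})
    (L : {linear 'M[R[i]]_n -> 'M[R[i]]_n}) (D : 'M[R[i]]_n)
    (Phi_qms : quantum_markov_semigroup Phi)
    (L_gen : is_generator Phi L)
    (Phi_primitive : primitive Phi L)
    (D_faithful : faithful_state D)
    (D_invariant : invariant_state Phi D)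
    (Phi_sym : kms_symmetric D Phi) :
  ((Num.sqrt (2 / conductance D L))%:E <= diam_L D L)%E /\
  (diam_L D L <=
     (2 * max_eigenvalue D / (min_eigenvalue D * conductance D L)
      * Num.sqrt (kms_opnorm D L / min_eigenvalue D))%:E)%E.
Proof.
have [_ L_ker] := Phi_primitive.
split; first exact: diam_lower n_ge2 Phi_qms L_gen L_ker D_faithful Phi_sym.
exact: diam_upper n_ge2 Phi_qms L_gen L_ker D_faithful Phi_sym.
Qed.
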